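(* Let $n\ge 3$ and let $\boldsymbol{\Omega}=\mathbf{Q}\boldsymbol{\Phi}\mathbf{Q}$ be the $n\times n$ matrix defined in the context. Then $\boldsymbol{\Omega}$ is positive semidefinite with nullity $2$, and all of its positive eigenvalues are simple. Let $$\lambda_1>\cdots>\lambda_{n-2}>0=\lambda_{n-1}=\lambda_n$$ be the eigenvalues of $\boldsymbol{\Omega}$. Then the following statements hold. \begin{enumerate} \item The kernel of $\boldsymbol{\Omega}$ is spanned by $(1,\ldots,1)^\top$ and $(1,2,\ldots,n)^\top$. \item For $k=1,\ldots,n-2$, the eigenvector of $\boldsymbol{\Omega}$ corresponding to $\lambda_k$ (unique up to a nonzero scalar) is even whenever $k-1$ is even, and odd whenever $k-1$ is odd. \item For $k=1,\ldots,n-2$, the eigenvector $\mathbf{u}$ of $\boldsymbol{\Omega}$ corresponding to $\lambda_k$ has $k+1$ sign changes, i.e. $S^-(\mathbf{u})=S^+(\mathbf{u})=k+1$, so that $S(\mathbf{u})=k+1$. \end{enumerate}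
   Context: Define $$\boldsymbol{\Omega}=\mathbf{Q}\boldsymbol{\Phi}\mathbf{Q},\qquad \boldsymbol{\Phi}=\bigl[\,|i-j|^3\,\bigr]_{i,j=1}^n,\qquad \mathbf{Q}=\mathbf{I}-\mathbf{X}(\mathbf{X}^\top\mathbf{X})^{-1}\mathbf{X}^\top,\qquad \mathbf{X}=\begin{bmatrix}1&1&\cdots&1\\1&2&\cdots&n\end{bmatrix}^\top,$$ where $\boldsymbol{\Omega},\boldsymbol{\Phi},\mathbf{Q}$ are real $n\times n$ matrices and $\mathbf{X}$ is $n\times 2$. Parity: let $\mathbf{Z}$ be the $n\times n$ matrix whose $(i,j)$ entry is $1$ if $i+j=n+1$ and $0$ otherwise. A vector $\mathbf{v}\in\mathbb{R}^n$ is even if $\mathbf{Z}\mathbf{v}=\mathbf{v}$ and odd if $\mathbf{Z}\mathbf{v}=-\mathbf{v}$. Sign changes: for a vector $\mathbf{u}=(u_1,\ldots,u_n)$, consider all ways of assigning a sign ($+$ or $-$) to each zero entry; for each assignment count the indices $i$ at which consecutive entries $u_i,u_{i+1}$ have opposite signs. $S^-(\mathbf{u})$ is the minimum and $S^+(\mathbf{u})$ the maximum of this count over all assignments. When $S^-(\mathbf{u})=S^+(\mathbf{u})$, the common value is denoted $S(\mathbf{u})$ and called the number of sign changes of $\mathbf{u}$. *)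

(* Defs.v *)
From mathcomp Require Import all_boot all_order all_algebra.
From mathcomp Require Import reals.

Set Implicit Arguments.
Unset Strict Implicit.
Unset Printing Implicit Defensive.

Import Order.TTheory GRing.Theory Num.Theory.
Local Open Scope ring_scope.

(* Indices i : 'I_n start at 0, so the 1-based index is i.+1. *)

Definition ones (R : realType) (n : nat) : 'cV[R]_n := const_mx 1.

Definition ramp (R : realType) (n : nat) : 'cV[R]_n := \col_(i < n) i.+1%:R.

Definition Xmx (R : realType) (n : nat) : 'M[R]_(n, 2) :=
  row_mx (ones R n) (ramp R n).

(* The inverse is genuine for 2 <= n; otherwise invmx is the identity on the
   singular matrix X^T X. *)
Definition Qmx (R : realType) (n : nat) : 'M[R]_n :=
  1%:M - Xmx R n *m invmx ((Xmx R n)^T *m Xmx R n) *m (Xmx R n)^T.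

Definition Phimx (R : realType) (n : nat) : 'M[R]_n :=
  \matrix_(i < n, j < n) `|i%:R - j%:R : R| ^+ 3.

Definition Omegamx (R : realType) (n : nat) : 'M[R]_n :=
  Qmx R n *m Phimx R n *m Qmx R n.

Definition pos_semidef (R : realType) (n : nat) (A : 'M[R]_n) : Prop :=
  A^T = A /\ forall v : 'cV[R]_n, 0 <= (v^T *m A *m v) 0 0.

(* The columns of cokermx A span {v | A *m v = 0}; kermx would give the
   left kernel. *)
Definition nullity (R : realType) (n : nat) (A : 'M[R]_n) : nat :=
  \rank (cokermx A).

(* Column eigenvectors; MathComp's eigenspace consists of row vectors. *)
Definition eigenvector (R : realType) (n : nat) (A : 'M[R]_n) (a : R)
    (v : 'cV[R]_n) : Prop :=
  v != 0 /\ A *m v = a *: v.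

Definition simple_eigenvalue (R : realType) (n : nat) (A : 'M[R]_n) (a : R) :
    Prop :=
  eigenvalue A a /\ mup a (char_poly A) = 1%N.

Definition Zmx (R : realType) (n : nat) : 'M[R]_n :=
  \matrix_(i < n, j < n) (i.+1 + j.+1 == n.+1)%N%:R.

Definition even_vec (R : realType) (n : nat) (v : 'cV[R]_n) : Prop :=
  Zmx R n *m v = v.

Definition odd_vec (R : realType) (n : nat) (v : 'cV[R]_n) : Prop :=
  Zmx R n *m v = - v.

(* s i = true stands for the sign + at i; the sign is free where u vanishes. *)
Definition sign_assignment (R : realType) (n : nat) (u : 'cV[R]_n)
    (s : {ffun 'I_n -> bool}) : bool :=
  [forall i, (u i 0 != 0) ==> (s i == (0 < u i 0))].

Definition sign_count (n : nat) (s : {ffun 'I_n -> bool}) : nat :=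
  #|[set p : 'I_n * 'I_n | (p.2 == p.1.+1 :> nat) && (s p.1 != s p.2)]|.

(* The assignment giving - to every zero entry: it witnesses that the set of
   assignments over which we take the minimum and maximum is nonempty. *)
Definition sign_default (R : realType) (n : nat) (u : 'cV[R]_n) :
    {ffun 'I_n -> bool} :=
  [ffun i => 0 < u i 0].

Lemma sign_defaultP (R : realType) (n : nat) (u : 'cV[R]_n) :
  sign_assignment u (sign_default u).
Proof. by apply/forallP => i; rewrite ffunE eqxx implybT. Qed.

Definition Sminus (R : realType) (n : nat) (u : 'cV[R]_n) : nat :=
  sign_count
    [arg min_(s < sign_default u | sign_assignment u s) sign_count s]%N.

Definition Splus (R : realType) (n : nat) (u : 'cV[R]_n) : nat :=
  sign_count
    [arg max_(s > sign_default u | sign_assignment u s) sign_count s]%N.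

(* Main.v *)
Require Import Defs.
From mathcomp Require Import all_boot all_order all_algebra.
From mathcomp Require Import reals complex.
From mathcomp Require Import ring lra zify.

Set Implicit Arguments.
Unset Strict Implicit.
Unset Printing Implicit Defensive.

Import Order.TTheory GRing.Theory Num.Theory.
Local Open Scope ring_scope.

(** Put m = n - 2 and let D be the m x n matrix of second differences. Its
    kernel is the space of affine vectors, so Q = D^T (D D^T)^-1 D
    ([Qmx_second_diff]) and Omega = D^T (D D^T)^-1 G (D D^T)^-1 D with
    G = D Phi D^T. The entries of G are fourth differences of |t|^3, which
    vanish at the integers |t| >= 2: G is the tridiagonal matrix with entries
    2, 8, 2, and it factors as (2/a) P P^T with P bidiagonal and positive
    ([second_diff_Phi]). Hence Omega is a positive multiple of a Gram matrix,
    which gives positivity and the kernel. An eigenvector u for l > 0 has the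
    form u = D^T w with l D D^T w = G w ([Omega_eigen]).

    Read w, with two zeros added at each end, as a sequence f. Then u is the
    second difference of f, and the fourth difference of f is a positive
    multiple of G w. Follow the number of sign changes around this cycle. By
    Rolle's theorem the first two differences gain a sign change each, because
    f and its first difference start and end with 0; the last two differences
    lose at most one each ([alternates_rolle]); and G, a product of two
    positive bidiagonal matrices, creates none ([alternates_linked]). A turn
    around the cycle leads from f back to f, so no step may gain anything more
    ([no_gain]). But there is an additional gain as soon as w has a zero first
    or last entry, or a block of zeros with the same sign on both sides occurs
    in f, in u or in one of their first differences ([touch_peaks]). Therefore
    the end entries of w and u are nonzero, so that an eigenvector is
    determined by its first entry and eigenspaces are lines; and every zero of
    w or u is isolated between two entries of opposite signs, so that
    S^- = S^+ ([linked_weak], [linked_diff2_weak]).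

    The sign changes of eigenvectors increase strictly as the eigenvalue
    decreases ([alternates_lt]): if w and w' belong to l > l', take the
    combination v = p w + q w' with v_1 = 0. The operator (D D^T)^-1 G does
    not increase sign changes; iterating it on v approaches the direction of
    w, iterating its inverse approaches that of w', and in between the zero
    first entry of v costs one sign change. So the m vectors w have 0, 1, ...,
    m - 1 sign changes in the order of decreasing eigenvalues, and each u has
    two more. Reversal of the coordinates commutes with Omega, so u is even or
    odd, and the parity can be read off from the number of sign changes
    between its nonzero ends ([maximal_chain_ends]).

    Finally, the spectral theorem turns the dimensions of the eigenspaces into
    the multiplicities of the roots of the characteristic polynomial
    ([symmetric_spectrum]). *)

(** * Alternating chains of indices *)

Definition has_sign (R : realFieldType) (s : bool) (x : R) : bool :=
  if s then 0 < x else x < 0.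

(** Sign changes are counted by increasing chains of indices along which the
    wanted sign alternates: if [P s i] says that the entry at [i] is strictly
    of sign [s], a chain with [k] steps exists iff S^- >= k; if it says that
    the entry is not strictly of the opposite sign, one exists iff S^+ >= k. *)
Fixpoint chain (P : bool -> nat -> Prop) (s : bool) (i k : nat) : Prop :=
  P s i /\
  if k is k'.+1 then exists2 j, (i < j)%N & chain P (~~ s) j k' else True.

Definition alternates (P : bool -> nat -> Prop) (k : nat) : Prop :=
  exists s i, chain P s i k.

Section Chains.

Implicit Types P Q : bool -> nat -> Prop.

Lemma chain_head P s i k : chain P s i k -> P s i.
Proof. by case: k => [|k] []. Qed.

(** All comparisons of sign changes that do not involve differences have this
    form: each index of a chain is moved to a nearby one, and indices that
    carry opposite signs stay in order. *)
Lemma chain_transfer P Q (r : bool -> nat -> nat -> Prop) :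
    (forall s i, P s i -> exists i', r s i i') ->
    (forall s i i', r s i i' -> Q s i') ->
    (forall s i i' j j', r s i i' -> r (~~ s) j j' -> (i < j)%N ->
       (i' < j')%N) ->
  forall k s i i', chain P s i k -> r s i i' -> chain Q s i' k.
Proof.
move=> Pr rQ rlt; elim=> [|k IH] s i i' /= [Pi ci] rii'.
  by split=> //; apply: rQ rii'.
split; first exact: rQ rii'.
case: ci => j ltij cj; have [j' rjj'] := Pr _ _ (chain_head cj).
by exists j'; [apply: rlt rii' rjj' ltij | apply: IH cj rjj'].
Qed.

Lemma alternates_transfer P Q (r : bool -> nat -> nat -> Prop) :
    (forall s i, P s i -> exists i', r s i i') ->
    (forall s i i', r s i i' -> Q s i') ->
    (forall s i i' j j', r s i i' -> r (~~ s) j j' -> (i < j)%N ->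
       (i' < j')%N) ->
  forall k, alternates P k -> alternates Q k.
Proof.
move=> Pr rQ rlt k [s [i ci]]; have [i' rii'] := Pr _ _ (chain_head ci).
by exists s, i'; apply: (chain_transfer Pr rQ rlt ci rii').
Qed.

Lemma alternates_sub P Q k :
  (forall s i, P s i -> Q s i) -> alternates P k -> alternates Q k.
Proof.
move=> sPQ; apply: (@alternates_transfer _ _ (fun s i i' => i = i' /\ P s i)).
- by move=> s i Pi; exists i.
- by move=> s i i' [<- /sPQ].
- by move=> s i i' j j' [<- _] [<- _].
Qed.

Lemma alternates_pred P k : alternates P k.+1 -> alternates P k.
Proof. by case=> s [i /= [_ [j _ cj]]]; exists (~~ s), j. Qed.

Lemma alternates_le P k l : (k <= l)%N -> alternates P l -> alternates P k.
Proof.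
move=> lekl; rewrite -(subnK lekl); elim: (l - k)%N => // d IH.
by rewrite addSn => /alternates_pred.
Qed.

Lemma chain_bound P N s i k :
  (forall s i, P s i -> (i < N)%N) -> chain P s i k -> (i + k < N)%N.
Proof.
move=> PN; elim: k s i => [|k IH] s i /= [/PN Pi]; first by rewrite addn0.
by case=> j ltij /IH; apply: leq_ltn_trans; rewrite addnS -addSn leq_add2r.
Qed.

Lemma alternates_bound P N k :
  (forall s i, P s i -> (i < N)%N) -> alternates P k -> (k < N)%N.
Proof.
move=> PN [s [i /(chain_bound PN)]]; apply: leq_ltn_trans.
exact: leq_addl.
Qed.

End Chains.

(** * Discrete Rolle theorem *)

Section Rolle.

Variable R : realFieldType.
Implicit Types f g : nat -> R.

Lemma has_signN s (x : R) : has_sign (~~ s) x = has_sign s (- x).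
Proof. by case: s; rewrite /has_sign /= ?oppr_gt0 ?oppr_lt0. Qed.

Lemma has_sign0 s : has_sign s (0 : R) = false.
Proof. by case: s; rewrite /has_sign ltxx. Qed.

Lemma has_signNF s (x : R) : has_sign s x -> has_sign (~~ s) x = false.
Proof. by case: s => /= H; apply/negbTE; rewrite -leNgt ltW. Qed.

Lemma has_signD s (x y : R) :
  has_sign s (x + y) -> has_sign s x \/ has_sign s y.
Proof.
case: s => /= H.
  by case: (ltP 0 x) => hx; [left | right]; lra.
by case: (ltP x 0) => hx; [left | right]; lra.
Qed.

Lemma has_signM s (c x : R) : 0 < c -> has_sign s (c * x) = has_sign s x.
Proof. by case: s => /= c0; rewrite ?pmulr_rgt0 ?pmulr_rlt0. Qed.

Lemma has_sign_neq0 (x : R) : x != 0 -> exists s, has_sign s x.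
Proof. by case: (ltgtP x 0) => // ? _; [exists false | exists true]. Qed.

Definition strict_at N f s i : Prop := (i < N)%N /\ has_sign s (f i).
Definition weak_at N f s i : Prop := (i < N)%N /\ ~~ has_sign (~~ s) (f i).

(** A chain that may also visit zeros, provided that two successive entries
    never vanish together and the last one is nonzero. Such chains can be
    longer than the strict ones, and Rolle's theorem applies to them as well:
    it needs only the signs of the increments. *)
Fixpoint peaks N f s i k : Prop :=
  (i < N)%N /\
  if k is k'.+1 then
    ~~ has_sign (~~ s) (f i) /\
    exists j, [/\ (i < j)%N, has_sign s (f i - f j) & peaks N f (~~ s) j k']
  else has_sign s (f i).

Fixpoint zigzag N f s i k : Prop :=
  (i < N)%N /\
  if k is k'.+1 then
    exists j, [/\ (i < j)%N, has_sign s (f j - f i) & zigzag N f (~~ s) j k']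
  else True.

Definition diff f (t : nat) : R := f t.+1 - f t.

Lemma chain_peaks N f s i k :
  chain (strict_at N f) s i k -> peaks N f s i k.
Proof.
elim: k s i => [|k IH] s i /= [[iN fi]] => [_|[j ltij cj]]; split=> //.
split; first by rewrite has_signNF.
exists j; split=> //; last exact: IH.
have [_] := chain_head cj.
by case: s fi {cj} => /=; lra.
Qed.

Lemma peaks_zigzag N f s i k : peaks N f s i k -> zigzag N f (~~ s) i k.
Proof.
elim: k s i => [|k IH] s i /= [iN] // [_ [j [ltij dj pj]]].
by split=> //; exists j; split=> //; [rewrite has_signN opprB | apply: IH].
Qed.

(** A final zero gives one more increment: from the last, strict, entry of the
    chain to that zero. *)
Lemma peaks_zigzag_end N f s i k e :
    peaks N f s i k -> (forall j, f j != 0 -> (j < N)%N -> (j < e)%N) ->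
  (e < N)%N -> f e = 0 -> zigzag N f (~~ s) i k.+1.
Proof.
move=> + Ne eN fe; elim: k s i => [|k IH] s i.
  case=> iN fi /=; split=> //; exists e; split=> //.
    by apply: Ne => //; apply: contraTneq fi => ->; rewrite has_sign0.
  by rewrite fe sub0r has_signN opprK.
case=> iN [_ [j [ltij dj pj]]]; split=> //; exists j.
by split=> //; [rewrite has_signN opprB | apply: IH].
Qed.

Lemma zigzag_start N f s i k :
    f 0%N = 0 -> has_sign s (f i) -> zigzag N f (~~ s) i k ->
  zigzag N f s 0 k.+1.
Proof.
move=> f0 fi zi; have iN: (i < N)%N by case: k zi => [|k] [].
split; first exact: leq_ltn_trans iN.
exists i; split=> //; last by rewrite f0 subr0.
by case: i fi {zi iN} => [|//]; rewrite f0 has_sign0.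
Qed.

Lemma diff_sign f s i j :
    (i < j)%N -> has_sign s (f j - f i) ->
  exists t, [/\ (i <= t)%N, (t < j)%N & has_sign s (diff f t)].
Proof.
elim: j => // j IH; rewrite ltnS leq_eqVlt => /predU1P[<- h|ltij].
  by exists i; rewrite leqnn ltnSn.
rewrite -(subrK (f j) (f j.+1)) -addrA => /has_signD[h|/(IH ltij)].
  by exists j; rewrite (ltnW ltij) ltnSn.
by case=> t [h1 h2 h3]; exists t; split=> //; apply: ltnW.
Qed.

Lemma zigzag_diff N f s i k :
    zigzag N.+1 f s i k.+1 ->
  exists2 t, (i <= t)%N & chain (strict_at N (diff f)) s t k.
Proof.
elim: k s i => [|k IH] s i [iN [j [ltij dj zj]]].
  have [t [it tj dt]] := diff_sign ltij dj; exists t => //.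
  by case: zj => jN _; do !split=> //; apply: leq_trans tj _.
have [t [it tj dt]] := diff_sign ltij dj; exists t => //.
have [u ju cu] := IH _ _ zj; split; last by exists u => //; apply: leq_trans ju.
by split=> //; case: zj => jN _; apply: leq_trans tj _.
Qed.

(** Between two successive points of a chain some difference has the sign of
    the increment, so [k] increments give [k - 1] sign changes of the
    differences. A zero at either end of the window adds an increment. *)
Lemma rolle N f s i k l :
    peaks N.+1 f s i k -> has_sign s (f i) ->
    (k + (f 0 == 0%R) + (f N == 0%R) = l.+1)%N ->
  alternates (strict_at N (diff f)) l.
Proof.
move=> pk fi kl.
suff [s' [i' zz]]: exists s' i', zigzag N.+1 f s' i' l.+1.
  by have [t _ ct] := zigzag_diff zz; exists s', t.
have z1: zigzag N.+1 f (~~ s) i (k + (f N == 0%R)).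
  case: (f N =P 0) => [fN|_]; last by rewrite addn0; apply: peaks_zigzag.
  rewrite addn1; apply: peaks_zigzag_end pk _ (ltnSn N) (fN).
  move=> j fj; rewrite ltnS (leq_eqVlt j) => /predU1P[ejN|//].
  by rewrite ejN fN eqxx in fj.
move: kl; rewrite addnAC => <-; case: (f 0%N =P 0) => [f0|_].
  by rewrite addn1; exists s, 0%N; apply: zigzag_start z1.
by rewrite addn0; exists (~~ s), i.
Qed.

(** Over such a block the sequence touches zero without changing sign, while
    its differences change sign twice more than Rolle's theorem predicts. *)
Definition touch N f a b : Prop :=
  [/\ (a.+1 < b)%N, (b < N)%N, 0 < f a * f b
    & forall t, (a < t)%N -> (t < b)%N -> f t = 0].

Lemma has_sign_prod (x y : R) : 0 < x * y ->
  exists s, has_sign s x /\ has_sign s y.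
Proof.
case: (ltgtP x 0) => [x0|x0|->]; last by rewrite mul0r ltxx.
  by exists false; split=> //=; rewrite -(nmulr_rgt0 _ x0).
by exists true; split=> //=; rewrite -(pmulr_rgt0 _ x0).
Qed.

Lemma same_or_opp (s t : bool) : s = t \/ s = ~~ t.
Proof. by case: s t => [] []; [left|right|right|left]. Qed.

Lemma sign_neq_index f s i j : has_sign s (f i) -> has_sign (~~ s) (f j) ->
  i <> j.
Proof. by move=> fi fj eij; rewrite -eij has_signNF in fj. Qed.

Lemma peaks_cons N f s i j k :
    (i < N)%N -> (i < j)%N -> ~~ has_sign (~~ s) (f i) ->
    has_sign s (f i - f j) -> peaks N f (~~ s) j k ->
  peaks N f s i k.+1.
Proof. by move=> iN ij fi fij pj; do 2?split=> //; exists j. Qed.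

Lemma peaks_cons_strict N f s i j k :
    (i < N)%N -> (i < j)%N -> has_sign s (f i) -> has_sign (~~ s) (f j) ->
  peaks N f (~~ s) j k -> peaks N f s i k.+1.
Proof.
move=> iN ij fi fj; apply: peaks_cons => //; first by rewrite has_signNF.
by case: s fi fj => /=; lra.
Qed.

Lemma peaks_cons_to0 N f s i j k :
    (i < N)%N -> (i < j)%N -> has_sign s (f i) -> f j = 0 ->
  peaks N f (~~ s) j k -> peaks N f s i k.+1.
Proof.
move=> iN ij fi fj; apply: peaks_cons => //; first by rewrite has_signNF.
by rewrite fj subr0.
Qed.

Lemma peaks_cons_from0 N f s i j k :
    (i < N)%N -> (i < j)%N -> f i = 0 -> has_sign (~~ s) (f j) ->
  peaks N f (~~ s) j k -> peaks N f s i k.+1.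
Proof.
move=> iN ij fi fj; apply: peaks_cons; rewrite // fi ?has_sign0 //.
by rewrite sub0r -has_signN.
Qed.

(** Going from [a] to the zero at [a + 1] and then to a later entry of the
    same sign inserts two increments into a chain. *)
Lemma touch_tail N f s a b j k :
    touch N f a b -> has_sign s (f a) -> (b <= j)%N -> has_sign s (f j) ->
  peaks N f s j k -> peaks N f s a k.+2.
Proof.
case=> ab bN _ z fa bj fj pj.
have aN : (a.+1 < N)%N by apply: ltn_trans bN.
have fa1 : f a.+1 = 0 by apply: z.
apply: (@peaks_cons_to0 _ _ _ a a.+1) => //; first exact: ltnW.
apply: (@peaks_cons_from0 _ _ _ a.+1 j); rewrite ?negbK //.
exact: leq_trans bj.
Qed.

Lemma touch_notin N f s a b j :
  touch N f a b -> has_sign s (f j) -> (a < j)%N -> (b <= j)%N.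
Proof.
case=> ab bN _ z fj aj; rewrite leqNgt.
by apply: contraL fj => /z-> //; rewrite has_sign0.
Qed.

Lemma touch_peaks_from N f a b s i k :
    touch N f a b -> (i <= a)%N -> chain (strict_at N f) s i k ->
  exists2 k', (k.+2 <= k')%N & peaks N f s i k'.
Proof.
move=> T; case: (T) => ab bN /has_sign_prod[sg [fa fb]] z.
have aN : (a < N)%N by apply: ltn_trans bN; apply: ltnW.
elim: k s i => [|k IH] s i ia [[iN fi] ci].
  have pb : peaks N f sg b 0 by [].
  have pa := touch_tail T fa (leqnn b) fb pb.
  case: (same_or_opp sg s) => es; subst sg.
    exists 2%N => //; have [_ _ _ z'] := T.
    apply: (@peaks_cons_to0 _ _ _ i a.+1) => //; first exact: z'.
    apply: (@peaks_cons_from0 _ _ _ a.+1 b); rewrite ?negbK //.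
      by apply: ltn_trans bN.
    exact: z'.
  exists 3%N => //; apply: (@peaks_cons_strict _ _ _ i a) => //.
  by rewrite ltn_neqAle ia andbT; apply/eqP; apply: sign_neq_index fi fa.
case: ci => j ltij cj; have [jN fj] := chain_head cj.
case: (leqP j a) => [ja|/(touch_notin T fj) bj].
  have [k' kk' pj] := IH _ _ ja cj.
  by exists k'.+1 => //; apply: (@peaks_cons_strict _ _ _ i j).
have pj := chain_peaks cj.
case: (same_or_opp sg s) => es; subst sg.
  have bj': (b < j)%N.
    by rewrite ltn_neqAle bj andbT; apply/eqP; apply: sign_neq_index fb fj.
  exists k.+3 => //; apply: (@peaks_cons_to0 _ _ _ i a.+1) => //;
    first exact: z.
  apply: (@peaks_cons_from0 _ _ _ a.+1 b); rewrite ?negbK //; last first.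
  - by apply: (@peaks_cons_strict _ _ _ b j).
  - exact: z.
  - exact: ltn_trans bN.
exists k.+3 => //; apply: (@peaks_cons_strict _ _ _ i a) => //.
  by rewrite ltn_neqAle ia andbT; apply/eqP; apply: sign_neq_index fi fa.
exact: (touch_tail T fa bj fj pj).
Qed.

(** A strict chain jumps over the block of zeros, either staying on the sign of
    its borders or changing sign across it; in both cases a detour through one
    zero of the block adds at least two steps. *)
Lemma touch_peaks N f a b k :
    touch N f a b -> alternates (strict_at N f) k ->
  exists s i k', [/\ (k.+2 <= k')%N, peaks N f s i k' & has_sign s (f i)].
Proof.
move=> T [s [i ci]]; have [iN fi] := chain_head ci.
case: (leqP i a) => [ia|ai].
  by have [k' kk' pk] := touch_peaks_from T ia ci; exists s, i, k'.
have bi := touch_notin T fi ai; have pi := chain_peaks ci.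
case: (T) => ab bN /has_sign_prod[sg [fa fb]] z.
case: (same_or_opp s sg) => es; subst s.
  by exists sg, a, k.+2; split=> //; apply: (touch_tail T fa bi fi pi).
have bi': (b < i)%N.
  by rewrite ltn_neqAle bi andbT; apply/eqP; apply: sign_neq_index fb fi.
exists sg, a, k.+3; split=> //; apply: (touch_tail T fa (leqnn b) fb).
exact: (@peaks_cons_strict _ _ _ b i).
Qed.

Lemma alternates_rolle N f k l :
    alternates (strict_at N.+1 f) k ->
    (l < k + (f 0 == 0%R) + (f N == 0%R))%N ->
  alternates (strict_at N (diff f)) l.
Proof.
case=> s [i ci] lk; have [_ fi] := chain_head ci.
have lk' := ltn_predK lk; rewrite -lk' ltnS in lk.
apply: (alternates_le lk); exact: rolle (chain_peaks ci) fi (esym lk').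
Qed.

Lemma alternates_rolle_touch N f a b k l :
    touch N.+1 f a b -> alternates (strict_at N.+1 f) k ->
    (l < k.+2 + (f 0 == 0%R) + (f N == 0%R))%N ->
  alternates (strict_at N (diff f)) l.
Proof.
move=> T /(touch_peaks T)[s [i [k' [kk' pk fi]]]] lk.
have {kk'}lk : (l < k' + (f 0 == 0%R) + (f N == 0%R))%N by lia.
have lk' := ltn_predK lk; rewrite -lk' ltnS in lk.
apply: (alternates_le lk); exact: rolle pk fi (esym lk').
Qed.

End Rolle.

(** * Zeros, bidiagonal maps and the eigenvalue cycle *)

Section Zeros.

Variable R : realFieldType.
Implicit Types f g : nat -> R.

Lemma sign_uniq s (x : R) : has_sign s x -> has_sign (~~ s) x -> False.
Proof. by move=> h; rewrite has_signNF. Qed.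

(** A positive combination of two neighbours has the sign of one of them; the
    neighbours chosen for two successive entries of a chain have opposite
    signs, so they are distinct and remain in order. *)
Lemma alternates_bidiagonal N (x v : nat -> R) al be k :
    0 < al -> 0 < be -> (forall t, (t < N)%N -> v t = al * x t + be * x t.+1) ->
  alternates (strict_at N v) k -> alternates (strict_at N.+1 x) k.
Proof.
move=> al0 be0 vE.
apply: (@alternates_transfer _ _ (fun s i i' =>
  (i' = i \/ i' = i.+1) /\ strict_at N.+1 x s i')).
- move=> s i [iN]; rewrite vE // => /has_signD[]; rewrite has_signM // => xi.
    by exists i; split; [left|split=> //; apply: ltnW].
  by exists i.+1; split; [right|split].
- by move=> s i i' [].
move=> s i i' j j' [ii' [_ xi]] [jj' [_ xj]] ij.
have : i' <> j' by move=> e; rewrite -e in xj; apply: sign_uniq xi xj.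
by lia.
Qed.

(** If every zero sits between neighbours of opposite signs, a chain through a
    zero can be moved to the neighbour that has the prescribed sign. *)
Lemma weak_to_strict N f k :
    f 0%N != 0 -> f N.-1 != 0 ->
    (forall t, (t.+2 < N)%N -> f t.+1 = 0 -> f t * f t.+2 < 0) ->
  alternates (weak_at N f) k -> alternates (strict_at N f) k.
Proof.
move=> f0 fN isol.
apply: (@alternates_transfer _ _ (fun s i i' =>
  (i' = i \/ (f i = 0 /\ (i' = i.+1 \/ i = i'.+1))) /\ strict_at N f s i')).
- move=> s i [iN wi].
  have [fi|fi] := eqVneq (f i) 0; last first.
    exists i; split; [by left|split=> //].
    have [s' fs'] := has_sign_neq0 fi.
    by case: (same_or_opp s' s) => es; subst s' => //; rewrite fs' in wi.
  case: i fi iN {wi} => [/eqP|t ft tN]; first by rewrite (negPf f0).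
  have tN2: (t.+2 < N)%N.
    rewrite ltn_neqAle tN andbT; apply: contraNneq fN => e.
    by rewrite -e /= ft.
  have := isol _ tN2 ft; rewrite -oppr_gt0 -mulrN => /has_sign_prod[s' [h1 h2]].
  case: (same_or_opp s' s) => es; subst s'.
    exists t; split; first by right; split=> //; right.
    by split=> //; apply: ltnW.
  exists t.+2; split; first by right; split=> //; left.
  by split=> //; rewrite -(negbK s) has_signN.
- by move=> s i i' [].
move=> s i i' j j' [ii' [_ xi]] [jj' [_ xj]] ij.
have d : i' <> j' by move=> e; rewrite -e in xj; apply: sign_uniq xi xj.
have zs s' k' : has_sign s' (f k') -> f k' <> 0 by move=> + e;
  rewrite e has_sign0.
have ij' : f i = 0 -> i <> j' by move=> + e; rewrite e; apply: zs xj.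
have ji' : f j = 0 -> j <> i' by move=> + e; rewrite e; apply: zs xi.
case: ii' => [ii'|[/ij' {}ij' ii']]; case: jj' => [jj'|[/ji' {}ji' jj']]; lia.
Qed.

(** A maximal block of zeros between entries of the same sign is a touch of
    [f]. Between entries of opposite signs, a block of length at least 2 makes
    the differences vanish between two differences of the same sign, which is
    a touch of [diff f]. *)
Lemma isolated_zeros N f :
    f 0%N != 0 -> f N != 0 -> (forall a b, ~ touch N.+1 f a b) ->
    (forall a b, ~ touch N (diff f) a b) ->
  forall t, (t.+2 < N.+1)%N -> f t.+1 = 0 -> f t * f t.+2 < 0.
Proof.
move=> f0 fN nt ntd t tN ft.
have exa : exists a, (a <= t)%N && (f a != 0) by exists 0%N.
have exb : exists b, (t.+2 <= b)%N && (f b != 0) by exists N; rewrite -ltnS tN.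
have uba a : (a <= t)%N && (f a != 0) -> (a <= t)%N by case/andP.
case: (ex_maxnP exa uba) => a /andP[aT fa] maxa {exa uba}.
case: (ex_minnP exb) => b /andP[bT fb] minb {exb}.
have z k : (a < k)%N -> (k < b)%N -> f k = 0.
  move=> ak kb; have [->//|kt] := eqVneq k t.+1; apply/eqP.
  apply: contraLR ak => fk; rewrite -leqNgt.
  have [kt'|kt'] := leqP k t; first by apply: maxa; rewrite kt'.
  have : (b <= k)%N by apply: minb; rewrite fk andbT; lia.
  by lia.
have bN : (b <= N)%N by apply: minb; rewrite fN andbT; lia.
case: (ltgtP (f a * f b) 0) => [ab|ab|/eqP]; last 2 first.
- by case: (nt a b); split=> //; lia.
- by rewrite mulf_eq0 (negPf fa) (negPf fb).
have [e|ltb] := eqVneq b a.+2.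
  have ea : a = t by lia.
  by rewrite -ea -e.
case: (ntd a b.-1); split; [lia|lia| |].
  rewrite /diff prednK ?(z a.+1) ?(z b.-1) ?sub0r ?subr0 //; try lia.
  by rewrite mulNr oppr_gt0.
by move=> k ak kb; rewrite /diff !z ?subr0 //; lia.
Qed.

Lemma touch_shift N f a b :
  touch N (fun t => f t.+2) a b -> touch N.+2 f a.+2 b.+2.
Proof.
by case=> ab bN fab z; split=> // -[|[|t]] // ta tb; apply: z.
Qed.

Lemma touch_widen N M f a b : (N <= M)%N -> touch N f a b -> touch M f a b.
Proof. by move=> NM [ab bN fab z]; split=> //; apply: leq_trans NM. Qed.

Lemma alternates_shift N f k :
  alternates (strict_at N (fun t => f t.+2)) k ->
    alternates (strict_at N.+2 f) k.
Proof.
apply: (@alternates_transfer _ _ (fun s i i' =>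
  i' = i.+2 /\ strict_at N.+2 f s i')).
- by move=> s i [iN fi]; exists i.+2.
- by move=> s i i' [].
by move=> s i i' j j' [-> _] [-> _].
Qed.

End Zeros.

Section Padded.

Variables (R : realFieldType) (m : nat).
Implicit Types f : nat -> R.

Definition diff2 f := diff (diff f).

(** With two zeros at each end of the window [0, m + 4), the second difference
    of [f] is D^T applied to the vector of the [m] entries in the middle. *)
Definition padded f := [/\ f 0%N = 0, f 1%N = 0, f m.+2 = 0 & f m.+3 = 0].

Lemma padded_diff_ends f : padded f -> diff f 0%N = 0 /\ diff f m.+2 = 0.
Proof. by case=> f0 f1 f2 f3; rewrite /diff f0 f1 f2 f3 subrr. Qed.

Lemma alternates_padded_diff f k : padded f ->
  alternates (strict_at m.+4 f) k -> alternates (strict_at m.+3 (diff f)) k.+1.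
Proof.
move=> [f0 f1 f2 f3] h; apply: (alternates_rolle h).
by rewrite f0 f3 eqxx; lia.
Qed.

Lemma alternates_padded_diff2 f k : padded f ->
  alternates (strict_at m.+3 (diff f)) k ->
    alternates (strict_at m.+2 (diff2 f)) k.+1.
Proof.
move=> /padded_diff_ends[g0 g1] h; apply: (alternates_rolle h).
by rewrite g0 g1 eqxx; lia.
Qed.

Lemma alternates_padded f k : padded f ->
  alternates (strict_at m.+4 f) k -> alternates (strict_at m.+2 (diff2 f)) k.+2.
Proof.
by move=> pf h; apply: alternates_padded_diff2; last
  exact: alternates_padded_diff.
Qed.

Lemma alternates_padded_touch f k x y : padded f ->
    touch m.+4 f x y \/ touch m.+3 (diff f) x y ->
  alternates (strict_at m.+4 f) k -> alternates (strict_at m.+2 (diff2 f)) k.+4.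
Proof.
move=> pf; case=> T h.
  apply: alternates_padded_diff2 => //; apply: (alternates_rolle_touch T h).
  by case: pf => -> _ _ ->; rewrite eqxx; lia.
apply: (alternates_rolle_touch T (alternates_padded_diff pf h)).
by case: (padded_diff_ends pf) => -> ->; rewrite eqxx; lia.
Qed.

Lemma alternates_diff2 N f k :
  alternates (strict_at N.+2 f) k.+2 -> alternates (strict_at N (diff2 f)) k.
Proof.
move=> h; have /alternates_rolle : alternates (strict_at N.+1 (diff f)) k.+1.
  by apply: (alternates_rolle h); lia.
by apply; lia.
Qed.

Lemma alternates_diff2_end N f k :
    f 0%N = 0 \/ f N.+1 = 0 -> alternates (strict_at N.+2 f) k.+2 ->
  alternates (strict_at N (diff2 f)) k.+1.
Proof.
move=> fe h; have /alternates_rolle : alternates (strict_at N.+1 (diff f)) k.+2.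
  by apply: (alternates_rolle h); case: fe => ->; rewrite eqxx; lia.
by apply; lia.
Qed.

(** Each of the two differences may lose a sign change; a touch, like the zero
    end in the lemma before, compensates for one of these losses. *)
Lemma alternates_diff2_touch N f k x y :
    touch N.+2 f x y \/ touch N.+1 (diff f) x y ->
  alternates (strict_at N.+2 f) k.+2 -> alternates (strict_at N (diff2 f)) k.+1.
Proof.
case=> T h.
  have /alternates_rolle : alternates (strict_at N.+1 (diff f)) k.+2.
    by apply: (alternates_rolle_touch T h); lia.
  by apply; lia.
have h1 : alternates (strict_at N.+1 (diff f)) k.+1.
  by apply: (alternates_rolle h); lia.
by apply: (alternates_rolle_touch T h1); lia.
Qed.

End Padded.

Section Cycle.

Variables (R : realFieldType) (m : nat) (a c : R).
Hypotheses (a0 : 0 < a) (c0 : 0 < c).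
Implicit Types f : nat -> R.

(** The relation D D^T w = c P P^T w' between the vectors in the middle of [f]
    and [f'], where P has rows (..., 1, a, ...). *)
Definition linked f f' := forall t, (t < m)%N ->
  diff2 (diff2 f) t
  = c * (a * f' t.+1 + (1 + a ^+ 2) * f' t.+2 + a * f' t.+3).

(** The tridiagonal map on the right-hand side is the composition of the
    bidiagonal maps with weights (a, 1) and (1, a). *)
Lemma alternates_linked f f' k : linked f f' ->
  alternates (strict_at m (diff2 (diff2 f))) k ->
  alternates (strict_at m.+4 f') k.
Proof.
move=> lk /(@alternates_bidiagonal _ m
  (fun t => c * (f' t.+2 + a * f' t.+1)) _ 1 a _ ltr01 a0) h.
have {h}: alternates (strict_at m.+1 (fun t => c * (f' t.+2 + a * f' t.+1))) k.
  by apply: h => t tm; rewrite (lk _ tm); ring.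
move=> /(@alternates_bidiagonal _ m.+1 (fun t => f' t.+1) _ (c * a) c k) h.
have {h}: alternates (strict_at m.+2 (fun t => f' t.+1)) k.
  by apply: h => [||t _]; rewrite ?mulr_gt0 //; ring.
apply: (@alternates_transfer _ _ (fun s i i' =>
  i' = i.+1 /\ strict_at m.+4 f' s i')).
- by move=> s i [iN fi]; exists i.+1; split=> //; split=> //; lia.
- by move=> s i i' [].
by move=> s i i' j j' [-> _] [-> _].
Qed.

Variables f f' : nat -> R.
Hypotheses (pf : padded m f) (lk : linked f f').

(** One step of the inverse of (D D^T)^-1 P P^T: two sign changes are gained
    on the way to the second difference and at most two are lost afterwards.
    The two lemmas that follow list the circumstances in which one more is
    gained. *)
Lemma alternates_link k :
  alternates (strict_at m.+4 f) k -> alternates (strict_at m.+4 f') k.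
Proof.
by move=> /(alternates_padded pf) /alternates_diff2 /(alternates_linked lk).
Qed.

Lemma alternates_link_end k : f 2%N = 0 \/ f m.+1 = 0 ->
  alternates (strict_at m.+4 f) k -> alternates (strict_at m.+4 f') k.+1.
Proof.
move=> fe /(alternates_padded pf) h; apply: (alternates_linked lk).
apply: alternates_diff2_end h; case: pf => f0 f1 f2 f3.
rewrite /diff2 /diff f0 f1 f2 f3.
by case: fe => ->; [left|right]; rewrite !subrr.
Qed.

Lemma alternates_link_touch k x y :
    touch m.+4 f x y \/ touch m.+3 (diff f) x y \/
    touch m.+2 (diff2 f) x y \/ touch m.+1 (diff (diff2 f)) x y ->
  alternates (strict_at m.+4 f) k -> alternates (strict_at m.+4 f') k.+1.
Proof.
move=> T h; apply: (alternates_linked lk).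
have h2 := alternates_padded pf h.
case: T => [T|[T|T]]; last exact: alternates_diff2_touch T h2.
  apply/alternates_pred/alternates_diff2.
  by apply: (alternates_padded_touch pf (or_introl T) h).
apply/alternates_pred/alternates_diff2.
by apply: (alternates_padded_touch pf (or_intror T) h).
Qed.

End Cycle.

Section Eigen.

Variables (R : realFieldType) (m : nat) (a c : R).
Hypotheses (a0 : 0 < a) (c0 : 0 < c).
Variable f : nat -> R.
Hypotheses (pf : padded m f) (lk : linked m a c f f).
Hypothesis (fN0 : alternates (strict_at m.+4 f) 0).

(** For an eigenvector the link leads from [f] to itself. A gain in each turn
    would produce arbitrarily many sign changes. *)
Lemma no_gain :
  ~ (forall k, alternates (strict_at m.+4 f) k ->
    alternates (strict_at m.+4 f) k.+1).
Proof.
move=> gain; have h k : alternates (strict_at m.+4 f) k.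
  by elim: k => // k; apply: gain.
have bd s i : strict_at m.+4 f s i -> (i < m.+4)%N by case.
by have := alternates_bound bd (h m.+4); rewrite ltnn.
Qed.

Lemma linked_head_neq0 : f 2%N != 0.
Proof.
apply/eqP => f2; apply: no_gain => k.
exact: (alternates_link_end a0 c0 pf lk (or_introl f2)).
Qed.

Lemma linked_last_neq0 : f m.+1 != 0.
Proof.
apply/eqP => f2; apply: no_gain => k.
exact: (alternates_link_end a0 c0 pf lk (or_intror f2)).
Qed.

Lemma linked_no_touch x y :
  ~ (touch m.+4 f x y \/ touch m.+3 (diff f) x y \/
    touch m.+2 (diff2 f) x y \/ touch m.+1 (diff (diff2 f)) x y).
Proof.
move=> T; apply: no_gain => k; exact: (alternates_link_touch a0 c0 pf lk T).
Qed.

Hypothesis m0 : (0 < m)%N.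

(** Without touches all zeros are isolated sign changes, hence S^- = S^+: for
    the vector w here, and for u = D^T w in [linked_diff2_weak] below. *)
Lemma linked_weak k :
  alternates (weak_at m (fun t => f t.+2)) k ->
    alternates (strict_at m (fun t => f t.+2)) k.
Proof.
case: m m0 pf lk fN0 linked_head_neq0 linked_last_neq0 linked_no_touch =>
  // N _ _ _ _ f2 fN nt.
apply: weak_to_strict => //; apply: isolated_zeros => // x y T.
  have T2 := touch_shift T.
  by case: (nt x.+2 y.+2); left; apply: (touch_widen _ T2); lia.
have T2 := @touch_shift _ _ (diff f) _ _ T.
by case: (nt x.+2 y.+2); right; left; apply: (touch_widen _ T2); lia.
Qed.

Lemma linked_diff2_ends : diff2 f 0%N != 0 /\ diff2 f m.+1 != 0.
Proof.
have := linked_head_neq0; have := linked_last_neq0; case: pf => f0 f1 f2 f3.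
by rewrite /diff2 /diff f0 f1 f2 f3 !subr0 !sub0r opprK.
Qed.

Lemma linked_diff2_weak k :
  alternates (weak_at m.+2 (diff2 f)) k ->
    alternates (strict_at m.+2 (diff2 f)) k.
Proof.
have [u0 uN] := linked_diff2_ends.
apply: weak_to_strict => //; apply: isolated_zeros => // x y T;
  apply: (@linked_no_touch x y); tauto.
Qed.

Lemma linked_diff2_alternates k :
  alternates (strict_at m.+2 (diff2 f)) k.+2 -> alternates (strict_at m.+4 f) k.
Proof.
by move=> /alternates_diff2; apply: (alternates_linked a0 c0 lk).
Qed.

End Eigen.

(** * Comparison of two eigenvectors *)

Lemma bernoulli (R : realFieldType) (d : R) k : 0 <= d ->
  1 + k%:R * d <= (1 + d) ^+ k.
Proof.
move=> d0; elim: k => [|k IH]; first by rewrite mul0r addr0 expr0.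
have h : (1 + d) * (1 + k%:R * d) <= (1 + d) ^+ k.+1.
  by rewrite exprS ler_wpM2l // addr_ge0.
apply: le_trans h; rewrite -natr1.
have : 0 <= k%:R * d * d by rewrite !mulr_ge0.
by nra.
Qed.

Section Compare.

Variable R : archiRealFieldType.

Lemma geometric_lt (r x y : R) :
  0 < r < 1 -> 0 < y -> exists k, forall l, (k <= l)%N -> r ^+ l * `|x| < y.
Proof.
case/andP=> r0 r1 y0; set d := r^-1 - 1.
have d0 : 0 < d by rewrite subr_gt0 invf_gt1.
have q0 : 0 <= `|x| / (y * d) by rewrite divr_ge0 // mulr_ge0 ?ltW.
exists (Num.Def.archi_bound (`|x| / (y * d))) => l kl.
have h1 : `|x| / (y * d) < l%:R.
  by apply: lt_le_trans (archi_boundP q0) _; rewrite ler_nat.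
have h2 : `|x| < l%:R * d * y.
  by rewrite -mulrA (mulrC d) -ltr_pdivrMr // mulr_gt0.
have h3 : 1 + l%:R * d <= r ^- l.
  by rewrite -exprVn -(subrKC 1 r^-1); apply: bernoulli; apply: ltW.
rewrite mulrC -ltr_pdivlMr ?exprn_gt0 // mulrC.
by apply: lt_le_trans h2 _; rewrite ler_pM2r //; lra.
Qed.

Lemma geometric_dominated (r : R) (x y : nat -> R) N : 0 < r < 1 ->
  exists k, forall l i, (k <= l)%N -> (i < N)%N -> y i != 0 ->
    r ^+ l * `|x i| < `|y i|.
Proof.
move=> r01; elim: N => [|N [k IH]]; first by exists 0%N.
have [yN|yN] := eqVneq (y N) 0.
  exists k => l i kl; rewrite ltnS leq_eqVlt => /predU1P[->|/IH];
    first by rewrite yN eqxx.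
  exact.
have yN0 : 0 < `|y N| by rewrite normr_gt0.
have [k' hk'] := geometric_lt (x N) r01 yN0.
exists (maxn k k') => l i; rewrite geq_max => /andP[kl k'l].
rewrite ltnS leq_eqVlt => /predU1P[->|iN]; first by move=> _; apply: hk'.
exact: IH.
Qed.

(** Used in place of limits: once one term of a combination is dominated, the
    signs are those of the other term. *)
Lemma has_sign_dominated s (x y : R) :
  `|x| < `|y| -> has_sign s (x + y) = has_sign s y.
Proof.
by case: s => /= h; apply/idP/idP; move: h; case: (ltrgt0P x) => ?;
  case: (ltrgt0P y) => ?; lra.
Qed.

Lemma alternates_opp N (f : nat -> R) k :
  alternates (strict_at N f) k -> alternates (strict_at N (fun t => - f t)) k.
Proof.
case=> s [i ci]; exists (~~ s), i; elim: k s i ci => [|k IH] s i [[iN fi] ci];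
  split=> //; rewrite /strict_at ?has_signN ?opprK //.
by case: ci => j ij cj; exists j => //; apply: IH.
Qed.

Lemma alternates_scale N c (f : nat -> R) k : c != 0 ->
  alternates (strict_at N f) k -> alternates (strict_at N (fun t => c * f t)) k.
Proof.
case: (ltgtP c 0) => // c0 _ h; last first.
  by apply: alternates_sub h => s i [iN fi]; split; rewrite // has_signM.
apply: alternates_sub (alternates_opp h) => s i [iN fi]; split=> //.
by rewrite -[c]opprK mulNr -mulrN has_signM // oppr_gt0.
Qed.

Lemma alternates_window m (f : nat -> R) k : padded m f ->
  alternates (strict_at m.+4 f) k ->
    alternates (strict_at m (fun t => f t.+2)) k.
Proof.
move=> [f0 f1 f2 f3].
apply: (@alternates_transfer _ _ (fun s i i' =>
  i = i'.+2 /\ strict_at m (fun t => f t.+2) s i')).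
- move=> s [|[|i]] [iN fi]; rewrite ?f0 ?f1 ?has_sign0 // in fi.
  exists i; split=> //; split=> //; rewrite ltnNge; apply: contraL fi => mi.
  have [->|->] : i = m \/ i = m.+1 by lia.
    by rewrite f2 has_sign0.
  by rewrite f3 has_sign0.
- by move=> s i i' [].
by move=> s i i' j j' [-> _] [-> _].
Qed.

Lemma alternates_unwindow m (f : nat -> R) k :
  alternates (strict_at m (fun t => f t.+2)) k ->
    alternates (strict_at m.+4 f) k.
Proof.
move=> /alternates_shift; apply: alternates_sub => s i [iN fi].
by split=> //; apply: leq_trans iN _; rewrite !ltnS leqW.
Qed.

Variables (m : nat) (a c1 c2 : R) (f g : nat -> R).
Hypotheses (a0 : 0 < a) (c10 : 0 < c1) (c12 : c1 < c2).
Hypotheses (pf : padded m f) (pg : padded m g).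
Hypotheses (lf : linked m a c1 f f) (lg : linked m a c2 g g).

Let y p (t : nat) : R := p * f t + g t.

Let padded_comb p : padded m (y p).
Proof.
by case: pf => f0 f1 f2 f3; case: pg => g0 g1 g2 g3; split;
  rewrite /y ?f0 ?f1 ?f2 ?f3 ?g0 ?g1 ?g2 ?g3 mulr0 addr0.
Qed.

Let linked_comb p : linked m a c2 (y p) (y (p * (c1 / c2))).
Proof.
move=> t tm; have c20 : c2 != 0 by rewrite gt_eqF // (lt_trans c10).
have -> : diff2 (diff2 (y p)) t = p * diff2 (diff2 f) t + diff2 (diff2 g) t.
  by rewrite /y /diff2 /diff; ring.
by rewrite lf // lg // /y; field.
Qed.

Let alternates_comb p k l :
  alternates (strict_at m.+4 (y p)) k ->
  alternates (strict_at m.+4 (y (p * (c1 / c2) ^+ l))) k.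
Proof.
elim: l => [|l IH] h; first by rewrite expr0 mulr1.
rewrite exprSr mulrA.
apply: (alternates_link a0 _ (padded_comb _) (linked_comb _)).
  exact: lt_trans c12.
exact: IH.
Qed.

(** The eigenvectors are scaled so that their sum [y 1] vanishes at the first
    entry. Each link multiplies the coefficient of [f] by r = c1 / c2 < 1, so
    the combinations run from one dominated by [f] to one dominated by [g],
    and the link at [y 1] gains a sign change. *)
Lemma alternates_lt_cancel k :
    f 2%N + g 2%N = 0 ->
    (forall k, alternates (weak_at m (fun t => g t.+2)) k ->
       alternates (strict_at m (fun t => g t.+2)) k) ->
  alternates (strict_at m.+4 f) k -> alternates (strict_at m.+4 g) k.+1.
Proof.
move=> fg2 gW fk; set r := c1 / c2.
have c20 : 0 < c2 by apply: lt_trans c12.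
have r0 : 0 < r by rewrite divr_gt0.
have r01 : 0 < r < 1 by rewrite r0 ltr_pdivrMr // mul1r.
(* l1, l2: how many links make the other vector negligible on each side *)
have [l1 h1] := geometric_dominated g f m.+4 r01.
have [l2 h2] := geometric_dominated f g m.+4 r01.
(* r ^- l1 weighs f so heavily that y has its signs wherever f is nonzero *)
have step1 : alternates (strict_at m.+4 (y (r ^- l1))) k.
  apply: alternates_sub fk => s i [iN fi]; split=> //.
  have fi0 : f i != 0 by apply: contraTneq fi => ->; rewrite has_sign0.
  rewrite -(has_signM s _ (_ : 0 < r ^+ l1)) ?exprn_gt0 // /y mulrDr.
  rewrite mulVKf ?expf_neq0 ?gt_eqF // addrC has_sign_dominated //.
  by rewrite normrM ger0_norm ?exprn_ge0 ?ltW //; apply: h1.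
have step2 : alternates (strict_at m.+4 (y 1)) k.
  have := alternates_comb l1 step1; rewrite -/r mulVf //.
  by rewrite expf_neq0 ?gt_eqF.
(* y 1 vanishes at index 2, the first entry after the padding *)
have step3 : alternates (strict_at m.+4 (y r)) k.+1.
  have := linked_comb 1; rewrite mul1r => lk.
  by apply: (alternates_link_end a0 c20 (padded_comb 1) lk) => //; left;
    rewrite /y mul1r.
have step4 : alternates (strict_at m.+4 (y (r ^+ l2.+1))) k.+1.
  by rewrite exprS; apply: alternates_comb.
(* a strict chain of a combination dominated by g is a weak chain of g *)
apply: alternates_unwindow; apply: gW.
apply: alternates_sub (alternates_window (padded_comb _) step4) => s i [im yi].
split=> //; have [->|gi0] := eqVneq (g i.+2) 0; first by rewrite has_sign0.
have im4 : (i.+2 < m.+4)%N by lia.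
have := h2 l2.+1 i.+2 (leqnSn _) im4 gi0.
have rl : 0 <= r ^+ l2.+1 by rewrite exprn_ge0 ?ltW.
rewrite -{1}(ger0_norm rl) -normrM.
move=> hd; rewrite /y (has_sign_dominated _ hd) in yi.
by rewrite has_signNF.
Qed.

End Compare.

(** The constant of a link is inversely proportional to the eigenvalue, so [g]
    belongs to the smaller one. *)
Lemma alternates_lt (R : archiRealFieldType) m (a c1 c2 : R) f g k :
    0 < a -> 0 < c1 -> c1 < c2 -> padded m f -> padded m g ->
    linked m a c1 f f -> linked m a c2 g g -> f 2%N != 0 -> g 2%N != 0 ->
    (forall k, alternates (weak_at m (fun t => g t.+2)) k ->
       alternates (strict_at m (fun t => g t.+2)) k) ->
  alternates (strict_at m.+4 f) k -> alternates (strict_at m.+4 g) k.+1.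
Proof.
move=> a0 c10 c12 pf pg lf lg f2 g2 gW fk.
(* after scaling by q, f cancels g at the first entry *)
pose q := - (g 2%N / f 2%N).
have q0 : q != 0 by rewrite oppr_eq0 mulf_neq0 ?invr_neq0.
apply: (@alternates_lt_cancel _ m a c1 c2 (fun t => q * f t) g) => //.
- by case: pf => h0 h1 h3 h4; split; rewrite ?h0 ?h1 ?h3 ?h4 mulr0.
- move=> t tm; have -> : diff2 (diff2 (fun t => q * f t)) t
    = q * diff2 (diff2 f) t.
    by rewrite /diff2 /diff; ring.
  by rewrite lf //; ring.
- by rewrite /q mulNr divfK // addNr.
- exact: alternates_scale.
Qed.

(** * Sign assignments and parity *)

Section Parity.
Variables (R : realFieldType) (N : nat) (f : nat -> R).

Lemma chain_extend_last s i k :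
    chain (strict_at N.+1 f) s i k -> has_sign (~~ (s (+) odd k)) (f N) ->
  chain (strict_at N.+1 f) s i k.+1.
Proof.
elim: k s i => [|k IH] s i [Pi ci].
  rewrite addbF => fN; split=> //; exists N => //.
  case: Pi => iN fi; have /eqP : i <> N by apply: sign_neq_index fi fN.
  by lia.
move=> fN; split=> //; case: ci => j ij cj; exists j => //.
by apply: IH => //; move: fN; rewrite /= addbN addNb.
Qed.

(** A maximal chain starts with the sign of the first entry and stops with the
    sign of the last one, since otherwise that end could be added to it. *)
Lemma maximal_chain_ends k :
    f 0%N != 0 -> f N != 0 -> alternates (strict_at N.+1 f) k ->
    ~ alternates (strict_at N.+1 f) k.+1 ->
  exists s, has_sign s (f 0%N) /\ has_sign (s (+) odd k) (f N).
Proof.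
move=> f0 fN [s [i ci]] nk; exists s; split.
  have [s' fs'] := has_sign_neq0 f0.
  case: (same_or_opp s' s) => e; subst s' => //; case: nk.
  exists (~~ s), 0%N; split=> //; exists i; rewrite ?negbK //.
  have [_ fi] := chain_head ci.
  by rewrite lt0n; apply/eqP; apply: sign_neq_index fi fs'.
have [s' fs'] := has_sign_neq0 fN.
case: (same_or_opp s' (s (+) odd k)) => e; subst s' => //; case: nk.
by exists s, i; apply: chain_extend_last.
Qed.

End Parity.

Section Count.

Variables (N : nat) (sg : nat -> bool).
Let P s i := (i < N.+1)%N /\ sg i = s.
Let ch t : nat := sg t != sg t.+1.

Lemma change_between i j : (i < j)%N -> sg i != sg j ->
  (0 < \sum_(i <= t < j) ch t)%N.
Proof.
elim: j => // j IH; rewrite ltnS => ij sij; rewrite big_nat_recr //= addn_gt0.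
rewrite orbC /ch lt0b; have [e|//] := eqVneq (sg j) (sg j.+1).
rewrite /= IH //; last by rewrite e.
by rewrite ltn_neqAle ij andbT; apply: contraNneq sij => ->; rewrite e.
Qed.

Lemma chain_changes s i k :
  chain P s i k -> (k <= \sum_(i <= t < N) ch t)%N.
Proof.
elim: k s i => [//|k IH] s i [[iN si] [j ij cj]].
have [jN sj] := chain_head cj.
rewrite (@big_cat_nat _ _ _ j) //=; last exact: ltnW.
rewrite -add1n leq_add ?(IH _ _ cj) // change_between // si sj.
by case: s {si cj sj}.
Qed.

Lemma changes_chain i :
  (i <= N)%N -> chain P (sg i) i (\sum_(i <= t < N) ch t).
Proof.
move=> iN; rewrite -(subKn iN); elim: (N - i)%N (leq_subr i N) => [|d IH] dN.
  by rewrite subn0 big_geq.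
have e : (N - d = (N - d.+1).+1)%N by lia.
have {IH} := IH (ltnW dN); rewrite e => IH.
rewrite big_ltn; last by lia.
have Pi : P (sg (N - d.+1)%N) (N - d.+1)%N by split=> //; lia.
move: Pi IH; rewrite {2}/ch; move: (N - d.+1)%N => q Pq.
have [<-|] := eqVneq (sg q) (sg q.+1).
  rewrite add0n; case: (\sum_(_ <= _ < _) _)%N => [|k] [_ c]; split=> //.
  by case: c => j qj cj; exists j => //; apply: ltnW.
rewrite add1n => sq IH; split=> //; exists q.+1 => //.
by have <- : sg q.+1 = ~~ sg q by case: (sg q) (sg q.+1) sq => [] [].
Qed.

End Count.

Section SignCount.

Variables (R : realType) (N : nat) (u : 'cV[R]_N.+1).

(** Vectors are read as sequences on the natural numbers, extended by 0, so
    that differences need no arithmetic of bounded indices. *)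
Definition entries n (v : 'cV[R]_n) (t : nat) : R :=
  if insub t is Some i then v i 0 else 0.

Lemma entriesE n (v : 'cV[R]_n) (i : 'I_n) : entries v i = v i 0.
Proof. by rewrite /entries valK. Qed.

Lemma sign_count_sum (s : {ffun 'I_N.+1 -> bool}) :
  sign_count s = (\sum_(0 <= t < N) (s (inord t) != s (inord t.+1)))%N.
Proof.
transitivity (\sum_(i < N.+1) \sum_(j < N.+1)
    ((j == i.+1 :> nat) && (s i != s j)))%N.
  rewrite pair_bigA /= /sign_count -sum1dep_card big_mkcond /=.
  by apply: eq_bigr => p _; case: (_ && _).
rewrite big_ord_recr /= [X in (_ + X)%N]big1 ?addn0; last first.
  by move=> j _; rewrite ltn_eqF.
rewrite big_mkord; apply: eq_bigr => i _.
rewrite (bigD1 (inord i.+1)) //= big1 ?addn0; last first.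
  move=> j nj; case: eqP => // e; case/eqP: nj; apply/val_inj.
  by rewrite /= inordK ?e // ltnS.
rewrite inordK ?eqxx ?ltnS //=.
have -> // : widen_ord (leqnSn N) i = inord i.
by apply/val_inj; rewrite /= inordK // ltnS ltnW.
Qed.

Lemma alternates_sign_count s k : sign_assignment u s ->
  alternates (strict_at N.+1 (entries u)) k -> (k <= sign_count s)%N.
Proof.
move=> /forallP us h; rewrite sign_count_sum.
set P := fun s' i => (i < N.+1)%N /\ s (inord i) = s'.
have [s' [i /chain_changes c]] : alternates P k.
  apply: alternates_sub h => s' i [iN fi]; split=> //.
  have := us (inord i); have := entriesE u (inord i); rewrite inordK // => <-.
  have fi0 : entries u i != 0 by apply: contraTneq fi => ->; rewrite has_sign0.
  move=> /implyP/(_ fi0)/eqP ->.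
  by case: s' fi => //= fi; rewrite ltNge ltW.
apply: leq_trans c _; case: (leqP i N) => iN; last by rewrite big_geq // ltnW.
by rewrite [leqRHS](@big_cat_nat _ _ _ i) //= leq_addl.
Qed.

Lemma sign_count_alternates s : sign_assignment u s ->
  alternates (weak_at N.+1 (entries u)) (sign_count s).
Proof.
move=> /forallP us; rewrite sign_count_sum.
have := @changes_chain N (fun t => s (inord t)) 0%N (leq0n _).
set k := (\sum_(_ <= _ < _) _)%N => c.
have: alternates (fun s' i => (i < N.+1)%N /\ s (inord i) = s') k by eexists _,
  _; exact: c.
apply: alternates_sub => s' i [iN si]; split=> //.
have := us (inord i); have := entriesE u (inord i); rewrite inordK // => <-.
rewrite si; case: s' {si} => /= /implyP h; rewrite -leNgt.
  by case: (ltgtP (entries u i) 0) h => // _ /(_ isT).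
by case: (ltgtP (entries u i) 0) h => // _ /(_ isT).
Qed.

(** Every sign assignment has at least as many changes as the longest strict
    chain, and is itself a weak chain. *)
Lemma Sminus_Splus_eq k :
    alternates (strict_at N.+1 (entries u)) k ->
    ~ alternates (weak_at N.+1 (entries u)) k.+1 ->
  Sminus u = k /\ Splus u = k.
Proof.
move=> sk wk.
have eqk s : sign_assignment u s -> sign_count s = k.
  move=> us; apply/eqP; rewrite eqn_leq (alternates_sign_count us sk) andbT.
  rewrite leqNgt; apply/negP => lk; apply: wk.
  exact: alternates_le lk (sign_count_alternates us).
rewrite /Sminus /Splus; split; apply: eqk.
  by case: arg_minnP => //; apply: sign_defaultP.
by case: arg_maxnP => //; apply: sign_defaultP.
Qed.

End SignCount.

(** * Band matrices *)

Section Gram.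
Variable R : realFieldType.

Lemma sqnorm_ge0 n (v : 'cV[R]_n) : 0 <= (v^T *m v) 0 0.
Proof. by rewrite mxE sumr_ge0 // => i _; rewrite mxE -expr2 sqr_ge0. Qed.

Lemma sqnorm_eq0 n (v : 'cV[R]_n) : (v^T *m v) 0 0 = 0 -> v = 0.
Proof.
rewrite mxE => /eqP; rewrite psumr_eq0; last first.
  by move=> i _; rewrite mxE -expr2 sqr_ge0.
move=> /allP h; apply/colP => i; rewrite mxE.
have := h i (mem_index_enum i); rewrite mxE /= -expr2 sqrf_eq0.
by move/eqP.
Qed.

Lemma gram_unitmx p n (B : 'M[R]_(p, n)) :
  (forall w : 'cV_p, B^T *m w = 0 -> w = 0) -> B *m B^T \in unitmx.
Proof.
move=> Binj; rewrite -row_free_unit; apply: inj_row_free => v vB.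
apply: trmx_inj; rewrite trmx0; apply: Binj; apply: sqnorm_eq0.
by rewrite trmx_mul !trmxK mulmxA -(mulmxA v) vB mul0mx mxE.
Qed.

End Gram.

Section Band.

Variables (R : realType) (m : nat).
Local Notation n := m.+2.

(** Both D and P have this shape. The last column of P is 0, which makes P^T w
    end with a zero and leaves P P^T as it is. *)
Definition band (c0 c1 c2 : R) : 'M[R]_(m, n) :=
  \matrix_(i < m, j < n) (c0 *+ (j == i :> nat) + c1 *+ (j == i.+1 :> nat)
                          + c2 *+ (j == i.+2 :> nat)).

Lemma sum_delta p (i : nat) (c : R) (v : 'I_p.+1 -> R) : (i < p.+1)%N ->
  \sum_(j < p.+1) (c *+ (j == i :> nat)) * v j = c * v (inord i).
Proof.
move=> ip; rewrite (bigD1 (inord i)) //= inordK // eqxx big1 ?addr0 //.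
move=> j ji; case: eqP => [e|]; last by rewrite mul0r.
by case/eqP: ji; apply: val_inj; rewrite /= inordK // e.
Qed.

Lemma band_mul c0 c1 c2 p (M : 'M[R]_(n, p)) i j :
  (band c0 c1 c2 *m M) i j
  = c0 * M (inord i) j + c1 * M (inord i.+1) j + c2 * M (inord i.+2) j.
Proof.
rewrite mxE; have im := ltn_ord i.
under eq_bigr do rewrite mxE !mulrDl.
by rewrite !big_split /= !(@sum_delta _ _ _ (fun k =>
  M k j)) // ltnS ltnW // ltnW.
Qed.

Lemma mul_band_tr c0 c1 c2 p (M : 'M[R]_(p, n)) i j :
  (M *m (band c0 c1 c2)^T) i j
  = c0 * M i (inord j) + c1 * M i (inord j.+1) + c2 * M i (inord j.+2).
Proof.
by rewrite -[M in LHS]trmxK -trmx_mul mxE band_mul !mxE.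
Qed.

Definition pad (w : 'cV[R]_m) (t : nat) : R :=
  if t is t'.+2 then entries w t' else 0.

Lemma entries_out p (w : 'cV[R]_p) t : (p <= t)%N -> entries w t = 0.
Proof. by move=> pt; rewrite /entries insubF // ltnNge pt. Qed.

Lemma entries_inord p (w : 'cV[R]_p.+1) t : (t < p.+1)%N ->
  entries w t = w (inord t) 0.
Proof. by move=> tp; rewrite -(entriesE w) inordK. Qed.

Lemma padded_pad w : padded m (pad w).
Proof. by split=> //=; apply: entries_out. Qed.

Lemma sum_entries (w : 'cV[R]_m) (t : nat) (c : R) :
  \sum_(i < m) (c *+ (t == i :> nat)) * w i 0 = c * entries w t.
Proof.
case: (ltnP t m) => tm; last first.
  rewrite entries_out // mulr0 big1 // => i _.
  by rewrite gtn_eqF ?mul0r // (leq_trans _ tm).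
rewrite (bigD1 (Ordinal tm)) //= eqxx big1 ?addr0.
  by rewrite -(entriesE w).
move=> i ni; case: eqP => [e|]; last by rewrite mul0r.
by case/eqP: ni; apply: val_inj; rewrite /= e.
Qed.

Lemma band_tr_mul c0 c1 c2 (w : 'cV[R]_m) t : (t < n)%N ->
  entries ((band c0 c1 c2)^T *m w) t
  = c0 * pad w t.+2 + c1 * pad w t.+1 + c2 * pad w t.
Proof.
move=> tn; rewrite entries_inord // mxE.
under eq_bigr do rewrite !mxE inordK // !mulrDl.
rewrite !big_split /= sum_entries; congr (_ + _ + _).
  case: t {tn} => [|t]; last by under eq_bigr do rewrite eqSS;
    rewrite sum_entries.
  by rewrite mulr0 big1 // => i _; rewrite mul0r.
case: t {tn} => [|[|t]]; last by under eq_bigr do rewrite !eqSS;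
  rewrite sum_entries.
  by rewrite mulr0 big1 // => i _; rewrite mul0r.
by rewrite mulr0 big1 // => i _; rewrite mul0r.
Qed.

Lemma entries_eq0 p (w : 'cV[R]_p) :
  (forall t, (t < p)%N -> entries w t = 0) -> w = 0.
Proof. by move=> h; apply/colP => i; rewrite mxE -entriesE h. Qed.

Lemma entries0 p t : entries (0 : 'cV[R]_p) t = 0.
Proof. by rewrite /entries; case: insubP => // i _ _; rewrite mxE. Qed.

(** The transpose is lower triangular with c0 on the diagonal. *)
Lemma band_tr_inj c0 c1 c2 (w : 'cV[R]_m) :
  c0 != 0 -> (band c0 c1 c2)^T *m w = 0 -> w = 0.
Proof.
move=> c00 Bw; apply: entries_eq0 => t.
elim/ltn_ind: t => t IH tm.
have := @band_tr_mul c0 c1 c2 w t (leqW (leqW tm)); rewrite Bw entries0.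
have {IH}z k : (k < t)%N -> entries w k = 0 by move=> kt;
  apply: IH (ltn_trans kt tm).
have -> : pad w t.+1 = 0 by case: t z {tm} => //= t -> //.
have -> : pad w t = 0 by case: t z {tm} => [|[|t]] //= -> //; apply: ltnW.
by rewrite !mulr0 !addr0 => /esym/eqP; rewrite mulf_eq0 (negPf c00) => /eqP.
Qed.

Definition second_diff_mx := band 1 (- 2) 1.
Definition bidiag_mx (a : R) := band 1 a 0.

Lemma second_diff_mx_tr_entries w t : (t < n)%N ->
  entries (second_diff_mx^T *m w) t = diff2 (pad w) t.
Proof. by move=> tn; rewrite band_tr_mul // /diff2 /diff; ring. Qed.

(** From matrices to sequences: the link used for counting sign changes. *)
Lemma linkedP a c x x' :
  second_diff_mx *m second_diff_mx^T *m x
    = c *: (bidiag_mx a *m (bidiag_mx a)^T *m x') ->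
  linked m a c (pad x) (pad x').
Proof.
move=> h t tm; have e := congr1 (fun v : 'cV_m => v (Ordinal tm) 0) h.
have t1 : (t < m.+2)%N by lia.
have t2 : (t.+1 < m.+2)%N by lia.
have t3 : (t.+2 < m.+2)%N by lia.
rewrite -!mulmxA [RHS]mxE /bidiag_mx !band_mul /= -!entries_inord // in e.
rewrite !second_diff_mx_tr_entries // !band_tr_mul // in e.
transitivity (1 * diff2 (pad x) t + -2 * diff2 (pad x) t.+1 +
     1 * diff2 (pad x) t.+2); first by rewrite /diff2 /diff; ring.
by rewrite e; ring.
Qed.

End Band.

(** * Factorization of Omega *)

Section Omega.

Variables (R : realType) (m : nat).
Local Notation n := m.+2.
Local Notation D := (second_diff_mx R m).
Local Notation X := (Xmx R n).

Lemma Xmx_mul (c : 'cV[R]_2) : X *m c = c 0 0 *: ones R n + c 1 0 *: ramp R n.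
Proof.
apply/colP => i; rewrite !mxE big_ord_recl big_ord1 !mxE.
case: splitP => k /= ek; last by lia.
case: splitP => l /= el; first by case: l el => -[].
rewrite (ord1 k) (ord1 l) !mxE.
rewrite mul1r mulr1 [X in _ + X = _]mulrC.
by congr (c _ _ + c _ _ * _); apply: val_inj.
Qed.

Lemma Xmx_inj (c : 'cV[R]_2) : X *m c = 0 -> c = 0.
Proof.
rewrite Xmx_mul => e.
have := congr1 (fun v : 'cV_n => v 0 0) e.
have := congr1 (fun v : 'cV_n => v (inord 1) 0) e.
rewrite !mxE inordK // !mulr1 => e1 e0; apply/colP => i; rewrite mxE.
case: (ltnP i 1) => i1.
  have -> : i = 0 by apply/val_inj => /=; lia.
  by lra.
have -> : i = 1 by apply/val_inj; rewrite /=; have := ltn_ord i; lia.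
by lra.
Qed.

Lemma gramX_unit : X^T *m X \in unitmx.
Proof.
by rewrite -[X in _ *m X]trmxK; apply: gram_unitmx => w; rewrite trmxK;
  apply: Xmx_inj.
Qed.

Lemma gramD_unit : D *m D^T \in unitmx.
Proof. by apply: gram_unitmx => w; apply: band_tr_inj; rewrite oner_neq0. Qed.

Lemma second_diff_ones : D *m ones R n = 0.
Proof. by apply/colP => i; rewrite band_mul !mxE; ring. Qed.

Lemma second_diff_ramp : D *m ramp R n = 0.
Proof.
apply/colP => i; rewrite band_mul !mxE; have im := ltn_ord i.
rewrite !inordK; try lia.
by rewrite -!natr1; ring.
Qed.

Lemma second_diff_X : D *m X = 0.
Proof.
apply/matrixP => i j; have := congr1 (fun v : 'cV_m => v i 0) (colE j (D *m X)).
rewrite -mulmxA Xmx_mul mulmxDr -!scalemxAr second_diff_ones second_diff_ramp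
  !scaler0 addr0.
by rewrite [LHS]mxE => ->; rewrite !mxE.
Qed.

Lemma second_diff_ker (v : 'cV[R]_n) : D *m v = 0 ->
  exists c : 'cV[R]_2, v = X *m c.
Proof.
move=> Dv; pose b := entries v 1 - entries v 0.
exists (\col_(i < 2) if i == 0 then entries v 0 - b else b).
rewrite Xmx_mul !mxE /=; apply/colP => i; rewrite !mxE -entriesE.
have -> : (val i).+1%:R = i%:R + 1 :> R by rewrite natr1.
have rec t : (t < m)%N -> entries v t.+2 = 2 * entries v t.+1 - entries v t.
  move=> tm; have := congr1 (fun v : 'cV_m => v (Ordinal tm) 0) Dv.
  rewrite band_mul /= mxE -!entries_inord; try lia.
  by lra.
have h : forall t, (t.+1 < n)%N ->
    entries v t = entries v 0 + t%:R * b /\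
    entries v t.+1 = entries v 0 + t.+1%:R * b.
  elim=> [|t IH] tn; first by rewrite /b; split; ring.
  have [e1 e2] := IH (ltnW tn); split=> //; rewrite rec ?e1 ?e2; last by lia.
  by rewrite -!natr1; ring.
case: i => -[|t] tn /=; first by rewrite /b; ring.
by have [_ ->] := h t tn; rewrite -!natr1; ring.
Qed.

(** Both sides are the orthogonal projection onto the complement of the affine
    vectors. The difference E of the two sides satisfies D E = 0, so that its
    columns are affine, and X^T E = 0, so that they are orthogonal to the
    affine vectors; hence it vanishes. *)
Lemma Qmx_second_diff : Qmx R n = D^T *m invmx (D *m D^T) *m D.
Proof.
apply/eqP; rewrite -subr_eq0; apply/eqP; set E := _ - _.
have DE : D *m E = 0.
  rewrite /E /Qmx !mulmxBr mulmx1 !mulmxA second_diff_X !mul0mx subr0.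
  by rewrite mulmxV ?gramD_unit // mul1mx subrr.
have XE : X^T *m E = 0.
  rewrite /E /Qmx !mulmxBr mulmx1 !mulmxA mulmxV ?gramX_unit // mul1mx subrr.
  by rewrite -trmx_mul second_diff_X trmx0 !mul0mx subrr.
apply/matrixP => i j.
have /second_diff_ker[c Ec] : D *m col j E = 0 by rewrite colE mulmxA DE mul0mx.
have : X^T *m (X *m c) = 0.
  by rewrite -Ec colE mulmxA XE mul0mx.
rewrite mulmxA => /(congr1 (mulmx (invmx (X^T *m X)))).
rewrite mulmxA mulVmx ?gramX_unit // mul1mx mulmx0 => c0.
by have := congr1 (fun v : 'cV_n => v i 0) Ec; rewrite c0 mulmx0 !mxE.
Qed.

(** The central fourth difference of |t|^3, a cubic B-spline: supported in
    [-2, 2] with values 8 at 0 and 2 at -1 and 1. *)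
Definition fourth_diff_abs3 (x : R) : R :=
  `|x + 2| ^+ 3 - 4 * `|x + 1| ^+ 3 + 6 * `|x| ^+ 3
  - 4 * `|x - 1| ^+ 3 + `|x - 2| ^+ 3.

Lemma fourth_diff_abs3_far (x : R) : 2 <= `|x| -> fourth_diff_abs3 x = 0.
Proof.
rewrite /fourth_diff_abs3; case: (ler0P x) => x0 h.
  by rewrite !ler0_norm; try lra; ring.
by rewrite !ger0_norm; try lra; ring.
Qed.

Lemma fourth_diff_abs3_0 : fourth_diff_abs3 0 = 8.
Proof.
by rewrite /fourth_diff_abs3 !add0r !normrN normr0 normr1 ger0_norm //; ring.
Qed.

Lemma fourth_diff_abs3_1 : fourth_diff_abs3 1 = 2.
Proof.
rewrite /fourth_diff_abs3 subrr normr0 normr1.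
rewrite (ler0_norm (_ : 1 - 2 <= 0)); last by lra.
by rewrite !ger0_norm; try lra; ring.
Qed.

Lemma fourth_diff_abs3N x : fourth_diff_abs3 (- x) = fourth_diff_abs3 x.
Proof.
rewrite /fourth_diff_abs3.
have -> : - x + 2 = - (x - 2) by ring.
have -> : - x + 1 = - (x - 1) by ring.
have -> : - x - 2 = - (x + 2) by ring.
have -> : - x - 1 = - (x + 1) by ring.
by rewrite !normrN; ring.
Qed.

(** P P^T is tridiagonal with entries a, 1 + a^2, a; the condition on [a] makes
    it proportional to 2, 8, 2. *)
Lemma second_diff_Phi (a : R) : 0 < a -> 1 + a ^+ 2 = 4 * a ->
  D *m Phimx R n *m D^T = (2 / a) *: (bidiag_mx m a *m (bidiag_mx m a)^T).
Proof.
move=> a0 ha; have an0 : a != 0 by rewrite gt_eqF.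
apply/matrixP => i j; rewrite [RHS]mxE mul_band_tr !band_mul !mxE.
have im := ltn_ord i; have jm := ltn_ord j.
rewrite !inordK; try lia.
rewrite !eqSS; transitivity (fourth_diff_abs3 (i%:R - j%:R)).
  rewrite -!natr1; move: (i%:R : R) (j%:R : R) => x y.
  have -> : x + 1 - y = x - y + 1 by ring.
  have -> : x + 1 + 1 - y = x - y + 2 by ring.
  have -> : x - (y + 1) = x - y - 1 by ring.
  have -> : x + 1 - (y + 1) = x - y by ring.
  have -> : x + 1 + 1 - (y + 1) = x - y + 1 by ring.
  have -> : x - (y + 1 + 1) = x - y - 2 by ring.
  have -> : x + 1 - (y + 1 + 1) = x - y - 1 by ring.
  have -> : x + 1 + 1 - (y + 1 + 1) = x - y by ring.
  by rewrite /fourth_diff_abs3; ring.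
have neqS k : (k == k.+1)%N = false by lia.
have Sneq k : (k.+1 == k)%N = false by lia.
have SSneq k : (k.+2 == k)%N = false by lia.
have neqSS k : (k == k.+2)%N = false by lia.
rewrite !mul0rn mul0r !addr0 mul1r.
case: (ltngtP i j) => ij; last first.
- rewrite ij subrr fourth_diff_abs3_0 ?neqS ?Sneq /=.
  rewrite (_ : 8 = 2 / a * (4 * a)); last by field.
  by rewrite -ha; ring.
- have [e|e] := eqVneq (i : nat) j.+1.
    rewrite e -natr1 addrAC subrr add0r fourth_diff_abs3_1 SSneq.
    by rewrite !mulr1n !mulr0n; field.
  rewrite fourth_diff_abs3_far; last first.
    by rewrite -natrB ?normr_nat ?ler_nat //; lia.
  have -> : (i.+1 == j :> nat) = false by lia.
  by rewrite !mulr0n; ring.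
have [e|e] := eqVneq (i.+1 : nat) j.
  rewrite -e -natr1 opprD addrA subrr add0r fourth_diff_abs3N fourth_diff_abs3_1
    neqSS.
  by rewrite !mulr1n !mulr0n; field.
rewrite fourth_diff_abs3_far; last first.
  by rewrite distrC -natrB ?normr_nat ?ler_nat //; lia.
have -> : (i == j.+1 :> nat) = false by lia.
by rewrite !mulr0n; ring.
Qed.

End Omega.

(** The condition makes P P^T proportional to the tridiagonal matrix with
    entries 2, 8, 2; positivity is what lets P act without creating sign
    changes. *)
Lemma spline_root (R : realType) : exists2 a : R, 0 < a & 1 + a ^+ 2 = 4 * a.
Proof.
exists (2 + Num.sqrt 3); first by rewrite ltr_wpDr ?sqrtr_ge0.
have : Num.sqrt 3 ^+ 2 = 3 :> R by rewrite sqr_sqrtr.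
by rewrite !expr2; lra.
Qed.

Section Factor.

Variables (R : realType) (m : nat) (a : R).
Hypotheses (a0 : 0 < a) (ha : 1 + a ^+ 2 = 4 * a).
Local Notation n := m.+2.
Local Notation D := (second_diff_mx R m).
Local Notation P := (bidiag_mx m a).
Local Notation X := (Xmx R n).
Local Notation Om := (Omegamx R n).
Let IA := invmx (D *m D^T).

Let IA_sym : IA^T = IA.
Proof. by rewrite /IA trmx_inv trmx_mul trmxK. Qed.

Let c0 : 0 < 2 / a. Proof. by rewrite divr_gt0. Qed.

Definition half_Omega := P^T *m IA *m D.

Lemma Omega_factor : Om = (2 / a) *: (half_Omega^T *m half_Omega).
Proof.
rewrite /Omegamx Qmx_second_diff -/IA /half_Omega.
have -> : D^T *m IA *m D *m Phimx R n *m (D^T *m IA *m D) =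
          D^T *m IA *m (D *m Phimx R n *m D^T) *m IA *m D by rewrite !mulmxA.
rewrite (second_diff_Phi m a0 ha) !trmx_mul IA_sym trmxK.
by rewrite -!scalemxAr -!scalemxAl !mulmxA.
Qed.

Lemma Omega_quad (v : 'cV[R]_n) :
  (v^T *m Om *m v) 0 0
  = (2 / a) * ((half_Omega *m v)^T *m (half_Omega *m v)) 0 0.
Proof.
rewrite Omega_factor -scalemxAr -scalemxAl [LHS]mxE (trmx_mul half_Omega v).
by rewrite !mulmxA.
Qed.

Lemma Omega_psd : pos_semidef Om.
Proof.
split=> [|v]; last by rewrite Omega_quad mulr_ge0 ?sqnorm_ge0 // ltW.
by rewrite Omega_factor linearZ /= trmx_mul trmxK.
Qed.

Lemma Omega_X : Om *m X = 0.
Proof.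
rewrite Omega_factor /half_Omega -scalemxAl -!mulmxA second_diff_X.
by rewrite !mulmx0 scaler0.
Qed.

Lemma Omega_ker (v : 'cV[R]_n) :
  Om *m v = 0 <-> exists c : 'cV[R]_2, v = X *m c.
Proof.
split=> [Ov|[c ->]]; last by rewrite mulmxA Omega_X mul0mx.
have := Omega_quad v; rewrite -mulmxA Ov mulmx0 [LHS]mxE => /esym/eqP.
rewrite mulf_eq0 gt_eqF //= => /eqP/sqnorm_eq0; rewrite /half_Omega -!mulmxA.
move=> /band_tr_inj; rewrite oner_neq0 => /(_ isT) /(congr1 (mulmx (D *m D^T))).
by rewrite mulmxA mulmxV ?gramD_unit // mul1mx mulmx0 => /second_diff_ker.
Qed.

(** Take w = l^-1 (D D^T)^-1 G (D D^T)^-1 D u, so that D^T w = l^-1 Omega u = u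
    and therefore (D D^T)^-1 D u = w. *)
Lemma Omega_eigen l (u : 'cV[R]_n) : l != 0 -> Om *m u = l *: u ->
  exists w : 'cV[R]_m,
    u = D^T *m w /\ D *m D^T *m w = (2 / a / l) *: (P *m P^T *m w).
Proof.
move=> l0 Ou.
have uE : u = D^T *m ((2 / a / l) *: (IA *m P *m P^T *m IA *m D *m u)).
  rewrite -[u in LHS](scalerK l0) -Ou Omega_factor /half_Omega !trmx_mul IA_sym
    trmxK.
  by rewrite -scalemxAl scalerA mulrC -scalemxAr !mulmxA.
set w := (_ *: _) in uE; exists w; split=> //.
have wE : IA *m D *m u = w by rewrite uE -!mulmxA (mulmxA D) mulKmx ?gramD_unit.
rewrite {1}/w -scalemxAr; congr (_ *: _).
rewrite -[_ *m IA *m D *m u]mulmxA -[_ *m IA *m (D *m u)]mulmxA (mulmxA IA) wE.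
by rewrite -!mulmxA mulmxA mulKVmx ?gramD_unit.
Qed.

(** What the counting of sign changes needs to know of an eigenvector. *)
Lemma eigen_profile l (u : 'cV[R]_n) : 0 < l -> eigenvector Om l u ->
  exists f : nat -> R,
    [/\ padded m f, linked m a (2 / a / l) f f, alternates (strict_at m.+4 f) 0
      & forall t, (t < n)%N -> entries u t = diff2 f t].
Proof.
move=> l0 [u0 /Omega_eigen[|w [uE wE]]]; first by rewrite gt_eqF.
exists (pad w); split; [exact: padded_pad|exact: linkedP| |].
  have [i wi] : exists i, w i 0 != 0.
    case: (pickP (fun i => w i 0 != 0)) => [i wi|w0]; first by exists i.
    case/eqP: u0; rewrite uE (_ : w = 0) ?mulmx0 //.
    by apply/colP => i; have /negbFE/eqP := w0 i; rewrite mxE.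
  have [s si] := has_sign_neq0 wi; exists s, (val i).+2; do 2!split=> //=.
    by have := ltn_ord i; lia.
  by rewrite entriesE.
by move=> t tn; rewrite uE second_diff_mx_tr_entries.
Qed.

End Factor.

(** * Reversal symmetry and eigenvectors of Omega *)

Section Reversal.

Variable R : realType.

Lemma Zmx_mul p q (M : 'M[R]_(p, q)) i j : (Zmx R p *m M) i j = M (rev_ord i) j.
Proof.
rewrite mxE (bigD1 (rev_ord i)) //= big1 ?addr0 => [|k nk]; rewrite mxE.
  by rewrite (_ : _ == _) ?mul1r //=; have := ltn_ord i; lia.
case: eqP => [e|]; last by rewrite mul0r.
by case/eqP: nk; apply/val_inj => /=; lia.
Qed.

Lemma Z_tr p : (Zmx R p)^T = Zmx R p.
Proof. by apply/matrixP => k l; rewrite !mxE addnC. Qed.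

Lemma mul_Zmx p q (M : 'M[R]_(p, q)) i j : (M *m Zmx R q) i j = M i (rev_ord j).
Proof.
by rewrite -[M]trmxK -{1}(Z_tr q) -trmx_mul mxE Zmx_mul !mxE.
Qed.

Lemma Zmx_involutive p q (M : 'M[R]_(p, q)) : Zmx R p *m (Zmx R p *m M) = M.
Proof. by apply/matrixP => i j; rewrite !Zmx_mul rev_ordK. Qed.

Variable m : nat.
Local Notation n := m.+2.
Local Notation D := (second_diff_mx R m).

(** The coefficients 1, -2, 1 form a palindrome. *)
Lemma Z_D : Zmx R m *m D = D *m Zmx R n.
Proof.
apply/matrixP => i j; rewrite Zmx_mul mul_Zmx !mxE /=.
have im := ltn_ord i; have jn := ltn_ord j.
have -> : (n - j.+1 == i)%N = (j == (m - i.+1).+2 :> nat)%N by lia.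
have -> : (n - j.+1 == i.+1)%N = (j == (m - i.+1).+1 :> nat)%N by lia.
have -> : (n - j.+1 == i.+2)%N = (j == (m - i.+1) :> nat)%N by lia.
by rewrite addrAC [RHS]addrAC [X in X + _ = _]addrC.
Qed.

Lemma Z_Dtr : Zmx R n *m D^T = D^T *m Zmx R m.
Proof. by apply: trmx_inj; rewrite !trmx_mul !trmxK !Z_tr Z_D. Qed.

Lemma Z_Q : Zmx R n *m Qmx R n = Qmx R n *m Zmx R n.
Proof.
rewrite Qmx_second_diff.
have ZA : Zmx R m *m invmx (D *m D^T) = invmx (D *m D^T) *m Zmx R m.
  rewrite -[LHS](mulKmx (gramD_unit R m)); congr (_ *m _).
  rewrite mulmxA -(mulmxA D) -Z_Dtr mulmxA -Z_D -(mulmxA (Zmx R m)) -mulmxA.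
  by rewrite mulmxV ?gramD_unit ?mulmx1.
by rewrite !mulmxA Z_Dtr -(mulmxA D^T) ZA -!mulmxA Z_D.
Qed.

Lemma Z_Phi : Zmx R n *m Phimx R n = Phimx R n *m Zmx R n.
Proof.
apply/matrixP => i j; rewrite Zmx_mul mul_Zmx !mxE.
have im := ltn_ord i; have jn := ltn_ord j.
rewrite /= !natrB; try lia.
by rewrite -normrN; congr (`|_| ^+ 3); rewrite -!natr1; ring.
Qed.

Lemma Z_Omega : Zmx R n *m Omegamx R n = Omegamx R n *m Zmx R n.
Proof.
by rewrite /Omegamx !mulmxA Z_Q -(mulmxA (Qmx R n)) Z_Phi -!mulmxA Z_Q.
Qed.

End Reversal.

Section Eigenvectors.

Variables (R : realType) (m : nat).
Hypothesis m0 : (0 < m)%N.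
Local Notation n := m.+2.
Local Notation Om := (Omegamx R n).
Local Notation changes u k := (alternates (strict_at n (entries u)) k).

Lemma eigen_ends l (u : 'cV[R]_n) : 0 < l -> eigenvector Om l u ->
  entries u 0 != 0 /\ entries u m.+1 != 0.
Proof.
move=> l0 eu; have [a a0 ha] := spline_root R.
have [f [pf lf f0 uf]] := eigen_profile a0 ha l0 eu.
have cl0 : 0 < 2 / a / l by rewrite !divr_gt0.
by rewrite !uf //; exact: (linked_diff2_ends a0 cl0 pf lf f0).
Qed.

Lemma changes_diff2 u (f : nat -> R) k :
  (forall t, (t < n)%N -> entries u t = diff2 f t) ->
  changes (u : 'cV[R]_n) k <-> alternates (strict_at n (diff2 f)) k.
Proof.
by move=> uf; split; apply: alternates_sub => s i [iN fi]; split=> //;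
  rewrite ?uf // -?uf.
Qed.

Lemma eigen_weak l (u : 'cV[R]_n) k : 0 < l -> eigenvector Om l u ->
  alternates (weak_at n (entries u)) k -> changes u k.
Proof.
move=> l0 eu wk; have [a a0 ha] := spline_root R.
have [f [pf lf f0 uf]] := eigen_profile a0 ha l0 eu.
have cl0 : 0 < 2 / a / l by rewrite !divr_gt0.
apply/(changes_diff2 _ uf)/(linked_diff2_weak a0 cl0 pf lf f0).
by apply: alternates_sub wk => s i [iN fi]; split; rewrite -?uf.
Qed.

Lemma eigen_changes2 l (u : 'cV[R]_n) : 0 < l -> eigenvector Om l u ->
  changes u 2.
Proof.
move=> l0 eu; have [a a0 ha] := spline_root R.
have [f [pf lf f0 uf]] := eigen_profile a0 ha l0 eu.
by apply/(changes_diff2 _ uf)/alternates_padded.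
Qed.

(** The comparison of the vectors w carries over to u = D^T w, which has two
    sign changes more than w. *)
Lemma eigen_changes_lt l l' (u u' : 'cV[R]_n) k : 0 < l' -> l' < l ->
    eigenvector Om l u -> eigenvector Om l' u' ->
  changes u k.+2 -> changes u' k.+3.
Proof.
move=> l'0 l'l eu eu'; have l0 := lt_trans l'0 l'l.
have [a a0 ha] := spline_root R.
have [f [pf lf f0 uf]] := eigen_profile a0 ha l0 eu.
have [g [pg lg g0 ug]] := eigen_profile a0 ha l'0 eu'.
have cl0 : 0 < 2 / a / l by rewrite !divr_gt0.
have cl'0 : 0 < 2 / a / l' by rewrite !divr_gt0.
move=> /(changes_diff2 _ uf) /(linked_diff2_alternates a0 cl0 lf) h.
apply/(changes_diff2 _ ug)/alternates_padded => //.
apply: (alternates_lt a0 cl0 _ pf pg lf lg) h.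
- by rewrite ltr_pM2l ?divr_gt0 // ltf_pV2.
- exact: (linked_head_neq0 a0 cl0 pf lf f0).
- exact: (linked_head_neq0 a0 cl'0 pg lg g0).
- by move=> ?; apply: (linked_weak a0 cl'0 pg lg g0).
Qed.

(** The combination of the two eigenvectors that vanishes at the first entry
    cannot be an eigenvector, by [eigen_ends]; so it is 0. *)
Lemma eigen_unique l (u v : 'cV[R]_n) : 0 < l ->
  eigenvector Om l u -> eigenvector Om l v ->
    exists2 c : R, c != 0 & v = c *: u.
Proof.
move=> l0 eu ev.
have [u0 _] := eigen_ends l0 eu; have [v0 _] := eigen_ends l0 ev.
pose c := entries v 0 / entries u 0.
exists c; first by rewrite mulf_neq0 ?invr_neq0.
apply/eqP; rewrite -subr_eq0; apply: contraT => w0.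
have /(eigen_ends l0)[]: eigenvector Om l (v - c *: u).
  split=> //; rewrite mulmxBr -scalemxAr (proj2 eu) (proj2 ev).
  by rewrite scalerBr !scalerA mulrC.
by move=> /eqP[]; rewrite entries_inord // !mxE -!entries_inord // /c divfK
  ?subrr.
Qed.

Variable lam : nat -> R.
Hypothesis lam_dec : forall j k : nat, (1 <= j)%N -> (j < k)%N ->
  (k <= m)%N -> lam k < lam j.
Hypothesis lam_gt0 : forall k : nat, (1 <= k <= m)%N -> 0 < lam k.
Hypothesis lam_eig : forall k : nat, (1 <= k <= m)%N ->
  exists u, eigenvector Om (lam k) u.

Lemma eigen_changes_lower k u : (k < m)%N -> eigenvector Om (lam k.+1) u ->
  changes u k.+2.
Proof.
elim: k u => [|k IH] u km eu; first by apply: eigen_changes2 eu; apply: lam_gt0.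
have [v ev] : exists v, eigenvector Om (lam k.+1) v by apply: lam_eig;
  rewrite /= ltnW.
apply: (eigen_changes_lt _ _ ev eu (IH _ (ltnW km) ev)); first exact: lam_gt0.
exact: lam_dec.
Qed.

(** One sign change too many would propagate down to the smallest positive
    eigenvalue, whose eigenvector would have n sign changes among n entries. *)
Lemma eigen_changes_upper k u : (k < m)%N -> eigenvector Om (lam k.+1) u ->
  ~ changes u k.+3.
Proof.
move=> km; have [d] : exists d, (k + d.+1 = m)%N by exists (m - k.+1)%N; lia.
elim: d k u km => [|d IH] k u km kd eu h.
  have := alternates_bound (fun s i (H : strict_at _ _ s i) => proj1 H) h; lia.
have km1 : (k.+1 < m)%N by lia.
have [v ev] : exists v, eigenvector Om (lam k.+2) v by apply: lam_eig.
apply: (IH k.+1 v) => //; first by lia.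
apply: (eigen_changes_lt _ _ eu ev h); first exact: lam_gt0.
exact: lam_dec.
Qed.

Lemma eigen_sign_changes k u : (k < m)%N -> eigenvector Om (lam k.+1) u ->
  Sminus u = k.+2 /\ Splus u = k.+2.
Proof.
move=> km eu; apply: Sminus_Splus_eq; first exact: eigen_changes_lower eu.
by move=> /(eigen_weak (lam_gt0 _) eu) - /(_ km); apply: eigen_changes_upper eu.
Qed.

(** Zu is an eigenvector as well, hence Zu = c u with c^2 = 1, and c is the
    sign of the quotient of the two end entries. *)
Lemma eigen_parity k u : (k < m)%N -> eigenvector Om (lam k.+1) u ->
  Zmx R n *m u = (-1) ^+ k *: u.
Proof.
move=> km eu; have lk0 : 0 < lam k.+1 by apply: lam_gt0.
have eZ : eigenvector Om (lam k.+1) (Zmx R n *m u).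
  case: eu => u0 Ou; split.
    by apply: contraNneq u0 => e; rewrite -(Zmx_involutive u) e mulmx0.
  by rewrite mulmxA -Z_Omega -mulmxA Ou scalemxAr.
have [c c0 Zu] := eigen_unique lk0 eu eZ.
have c2 : c ^+ 2 = 1.
  have := Zmx_involutive u; rewrite Zu -scalemxAr Zu scalerA -expr2 => e.
  have [i ui] : exists i, u i 0 != 0.
    by have [h _] := eigen_ends lk0 eu; exists (inord 0);
      rewrite -entries_inord.
  apply: (mulIf ui); have := congr1 (fun v : 'cV_n => v i 0) e.
  by rewrite mxE mul1r.
have [u0 uN] := eigen_ends lk0 eu.
(* exactly k + 2 sign changes; k + 2 and k have the same parity *)
have [s [s0 sN]] := maximal_chain_ends u0 uN (eigen_changes_lower km eu)
  (eigen_changes_upper km eu).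
have uNc : entries u m.+1 = c * entries u 0.
  have := congr1 (fun v : 'cV_n => v (inord 0) 0) Zu.
  rewrite Zmx_mul [RHS]mxE -entries_inord // => <-.
  rewrite entries_inord //; congr (u _ 0); apply/val_inj;
    rewrite /= !inordK //; lia.
rewrite Zu; congr (_ *: _); rewrite uNc /= negbK in sN.
move/eqP: c2; rewrite sqrf_eq1 => /orP[]/eqP e;
  rewrite e ?mul1r ?mulN1r in sN *.
  rewrite -signr_odd; case: (odd k) sN => //; rewrite addbT => h.
  by case: (sign_uniq s0 h).
rewrite -signr_odd; case: (odd k) sN => //; rewrite addbF -has_signN => h.
by case: (sign_uniq s0 h).
Qed.

End Eigenvectors.

(** * Spectrum *)

Lemma rank_diag_mx (F : fieldType) n (d : 'rV[F]_n) :
  \rank (diag_mx d) = #|[pred i | d 0 i != 0]|.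
Proof.
have E : (diag_mx d :=: \sum_(i | d 0%R i != 0%R) <<delta_mx 0%R i :
  'rV[F]_n>>)%MS.
  apply/eqmxP/andP; split.
    apply/row_subP => i; rewrite row_diag_mx.
    have [->|di] := eqVneq (d 0 i) 0; first by rewrite scale0r sub0mx.
    by rewrite (sumsmx_sup i) // genmxE scalemx_sub.
  apply/sumsmx_subP => i di; rewrite genmxE.
  rewrite -[delta_mx 0 i](scalerK di) scalemx_sub // -row_diag_mx.
  exact: row_sub.
rewrite E (mxdirectP _) /=; last by apply: (@mxdirect_delta _ _ _ _ id) => i j.
rewrite -sum1_card; apply: eq_bigr => i _.
by rewrite genmxE mxrank_delta.
Qed.

Lemma char_poly_conj (F : fieldType) n (P A : 'M[F]_n) : P \in unitmx ->
  char_poly (invmx P *m A *m P) = char_poly A.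
Proof.
move=> Pu; rewrite /char_poly.
have -> : char_poly_mx (invmx P *m A *m P) =
   map_mx polyC (invmx P) *m char_poly_mx A *m map_mx polyC P.
  rewrite /char_poly_mx mulmxBr mulmxBl !map_mxM; congr (_ - _).
  by rewrite -mulmxA mul_scalar_mx -scalemxAr -map_mxM mulVmx // map_mx1
    scalemx1.
rewrite !det_mulmx mulrAC -det_mulmx -map_mxM mulVmx // map_mx1 det1.
by rewrite mul1r.
Qed.

(** The spectral theorem is applied to the complexified matrix. Its eigenvalues
    are real, and ranks do not change under extension of the base field, so
    the multiplicity of [a] as a root is the dimension of the eigenspace. *)
Lemma symmetric_spectrum (R : realType) n (A : 'M[R]_n) : A^T = A ->
  exists d : 'I_n -> R, char_poly A = \prod_i ('X - (d i)%:P) /\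
    forall a, (#|[pred i | d i == a]| + \rank (A - a%:M)%R = n)%N.
Proof.
move=> As; pose f := [the {rmorphism R -> R[i]} of real_complex R].
have Ah : map_mx f A \is hermsymmx.
  apply: realsym_hermsym.
    by apply/is_hermitianmxP; rewrite expr0 scale1r map_mx_id // map_trmx As.
  by apply/mxOverP => i j; rewrite mxE; apply/complex_realP; exists (A i j).
have /orthomx_spectralP := hermitian_normalmx Ah.
have := hermitian_spectral_diag_real Ah; have := spectral_unit (map_mx f A).
set P := spectralmx _; set sp := spectral_diag _ => Pu /mxOverP spr AE.
pose d i := complex.Re (sp 0 i).
have fd i : f (d i) = sp 0 i by apply: RRe_real.
exists d; split.
  apply: (map_poly_inj f); rewrite map_char_poly AE char_poly_conj //.
  rewrite char_poly_trig ?diag_mx_is_trig // rmorph_prod.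
  apply: eq_bigr => i _; rewrite rmorphB /= map_polyX map_polyC /= fd.
  by rewrite mxE eqxx mulr1n.
move=> a; rewrite -(mxrank_map f) map_mxB map_scalar_mx AE.
have -> : invmx P *m diag_mx sp *m P - (f a)%:M =
  invmx P *m diag_mx (sp - const_mx (f a)) *m P.
  by rewrite linearB /= diag_const_mx mulmxBr mulmxBl mul_mx_scalar -scalemxAl
    mulVmx // scalemx1.
rewrite mxrankMfree ?row_free_unit // eqmxMfull ?row_full_unit ?unitmx_inv //.
rewrite rank_diag_mx -[RHS]card_ord -(cardC [pred i | d i == a]);
  congr (_ + _)%N.
apply: eq_card => i; rewrite !inE !mxE subr_eq0 -fd.
by rewrite (inj_eq (fmorph_inj f)).
Qed.

Lemma mup_prod_XsubC (F : fieldType) (a : F) (s : seq F) :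
  mup a (\prod_(x <- s) ('X - x%:P)) = count_mem a s.
Proof.
elim: s => [|x s IH]; first by rewrite big_nil mupNroot // rootC oner_neq0.
rewrite big_cons mupM ?polyXsubC_eq0 ?monic_neq0 ?monic_prod_XsubC // IH /=.
by have := mup_XsubCX 1 a x; rewrite expr1 => ->; rewrite eq_sym; case: eqP.
Qed.

(** No two positive entries coincide, so sorting them gives a strictly
    decreasing sequence; the remaining entries are the zeros. *)
Lemma positive_spectrum_seq (R : realType) (s : seq R) k :
    (forall x, x \in s -> 0 <= x) ->
    (forall x, 0 < x -> (count_mem x s <= 1)%N) ->
    count_mem 0 s = k ->
  exists t : seq R, [/\ perm_eq s (t ++ nseq k 0), sorted >%R t &
                        forall x, x \in t -> 0 < x].
Proof.
move=> s_ge0 s_simple s0; pose t := rev (sort <=%R [seq x <- s | 0 < x]).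
exists t; split; last by move=> x;
  rewrite mem_rev mem_sort mem_filter => /andP[].
  have <- : [seq x <- s | ~~ (0 < x)] = nseq k 0.
    rewrite -s0 -size_filter; set s' := [seq x <- s | pred1 0 x].
    have -> : [seq x <- s | ~~ (0 < x)] = s'.
      apply: eq_in_filter => x /s_ge0; rewrite /= -leNgt => x0.
      by rewrite eq_le x0 andbT.
    by apply/all_pred1P/allP => x; rewrite mem_filter => /andP[].
  rewrite perm_sym; apply: (@perm_trans _ ([seq x <- s | 0 < x] ++ [seq x <- s |
    ~~ (0 < x)])).
    by rewrite perm_cat2r perm_rev perm_sort.
  by rewrite perm_filterC.
rewrite rev_sorted lt_sorted_uniq_le sort_le_sorted andbT.
rewrite sort_uniq; apply: count_mem_uniq => x.
have [|xs] := boolP (x \in _); last by apply/count_memPn.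
rewrite mem_filter => /andP[x0 xs]; apply/eqP; rewrite eqn_leq -has_count.
apply/andP; split.
  apply: leq_trans (s_simple _ x0); rewrite count_filter.
  by apply: sub_count => y /andP[].
by rewrite has_pred1 mem_filter x0.
Qed.

Section Spectrum.

Variables (R : realType) (m : nat).
Local Notation n := m.+2.
Local Notation Om := (Omegamx R n).
Local Notation X := (Xmx R n).

Lemma Omega_psd0 : pos_semidef Om.
Proof. by have [a a0 ha] := spline_root R; apply: Omega_psd a0 ha. Qed.

Lemma Omega_sym : Om^T = Om. Proof. by case: Omega_psd0. Qed.

Lemma Omega_ker0 (v : 'cV[R]_n) :
  Om *m v = 0 <-> exists c : 'cV[R]_2, v = X *m c.
Proof. by have [a a0 ha] := spline_root R; apply: Omega_ker a0 ha _. Qed.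

Lemma row_eigenvector a (v : 'rV[R]_n) :
  v *m Om = a *: v -> v != 0 -> eigenvector Om a v^T.
Proof.
move=> vO v0; split; first by rewrite -(inj_eq trmx_inj) trmxK trmx0.
by rewrite -[in LHS]Omega_sym -trmx_mul vO linearZ.
Qed.

Lemma eigenvalue_eigenvector a :
  eigenvalue Om a <-> exists u, eigenvector Om a u.
Proof.
split=> [/eigenvalueP[v vO v0]|[u [u0 Ou]]]; first by exists v^T;
  apply: row_eigenvector.
apply/eigenvalueP; exists u^T; last by rewrite -(inj_eq trmx_inj) trmxK trmx0.
by rewrite -[in LHS]Omega_sym -trmx_mul Ou linearZ.
Qed.

Lemma eigenvector_ge0 a u : eigenvector Om a u -> 0 <= a.
Proof.
case=> u0 Ou; have := Omega_psd0.2 u; rewrite -mulmxA Ou -scalemxAr mxE.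
have u2 : 0 < (u^T *m u) 0 0.
  rewrite lt_def sqnorm_ge0 andbT; apply: contraNneq u0 => /sqnorm_eq0 ->.
  by [].
by rewrite pmulr_lge0.
Qed.

Lemma rank_ker_Omega : \rank (kermx Om) = 2%N.
Proof.
have -> : \rank (kermx Om) = \rank X^T.
  apply/eqP; rewrite eqn_leq !mxrankS //.
    apply/sub_kermxP; rewrite -[Om]Omega_sym -trmx_mul.
    have -> : Om *m X = 0; last by rewrite trmx0.
    by have [a a0 ha] := spline_root R; apply: Omega_X a0 ha.
  apply/row_subP => i; have : row i (kermx Om) *m Om = 0.
    by apply/sub_kermxP; apply: row_sub.
  move=> /(congr1 trmx); rewrite trmx_mul Omega_sym trmx0 => /Omega_ker0[c e].
  by rewrite -[row i _]trmxK e trmx_mul submxMl.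
apply/eqP; rewrite -[_ == _]/(row_free X^T); apply: inj_row_free => v.
move=> /(congr1 trmx); rewrite trmx_mul trmxK trmx0 => /Xmx_inj.
by move=> /(congr1 trmx); rewrite trmxK trmx0.
Qed.

Lemma nullity_Omega : nullity Om = 2%N.
Proof. by rewrite /nullity mxrank_coker -rank_ker_Omega mxrank_ker. Qed.

(** The first coordinate is injective on the eigenspace, by [eigen_ends]. *)
Lemma rank_eigenspace a : 0 < a -> (\rank (eigenspace Om a) <= 1)%N.
Proof.
move=> a0; pose B : 'M[R]_(n, 1) := delta_mx 0 0.
rewrite -(mxrank_mul_ker _ B).
have -> : (eigenspace Om a :&: kermx B)%MS = 0.
  apply/eqP/rowV0P => v; rewrite sub_capmx =>
    /andP[/eigenspaceP vO /sub_kermxP vB].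
  apply/eqP; apply: contraT => v0.
  have [/eqP[]] := eigen_ends a0 (row_eigenvector vO v0).
  rewrite entries_inord // mxE; have := congr1 (fun M : 'M_1 => M 0 0) vB.
  rewrite -colE !mxE => <-; congr (v _ _); apply/val_inj.
  by rewrite /= inordK.
by rewrite mxrank0 addn0 rank_leq_col.
Qed.

Lemma Omega_spectrum : exists t : seq R,
  [/\ char_poly Om = \prod_(x <- t ++ nseq 2 0) ('X - x%:P), size t = m,
      sorted >%R t & forall x, x \in t -> 0 < x].
Proof.
have [d [cd rd]] := symmetric_spectrum Omega_sym.
pose s := [seq d i | i <- enum 'I_n].
have cs a : count_mem a s = \rank (eigenspace Om a).
  rewrite /eigenspace mxrank_ker -[X in (X - _)%N](rd a) addnK count_map cardE.
  by rewrite -size_filter enumT.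
have s_ge0 x : x \in s -> 0 <= x.
  rewrite -has_pred1 has_count cs lt0n mxrank_eq0 => /eigenvalue_eigenvector[u].
  exact: eigenvector_ge0.
have s_simple x : 0 < x -> (count_mem x s <= 1)%N by rewrite cs;
  apply: rank_eigenspace.
have s0 : count_mem 0 s = 2%N.
  by rewrite cs /eigenspace raddf0 subr0 rank_ker_Omega.
have [t [st ts t0]] := positive_spectrum_seq s_ge0 s_simple s0.
exists t; split=> //.
  rewrite cd -(perm_big _ st) /= big_map.
  by rewrite big_enum.
have := perm_size st; rewrite size_cat size_nseq size_map size_enum_ord.
by rewrite addn2 => -[].
Qed.

End Spectrum.

Theorem theorem3p7 (R : realType) (n : nat) (hn : (3 <= n)%N) :
  [/\ pos_semidef (Omegamx R n),
      nullity (Omegamx R n) = 2%N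
    & forall a : R, 0 < a -> eigenvalue (Omegamx R n) a ->
        simple_eigenvalue (Omegamx R n) a] /\
  exists lam : nat -> R,
    (* lam 1 > ... > lam (n-2) > 0 = lam (n-1) = lam n are the eigenvalues,
       listed with multiplicity *)
    [/\ char_poly (Omegamx R n) = \prod_(1 <= k < n.+1) ('X - (lam k)%:P),
        forall j k : nat, (1 <= j)%N -> (j < k)%N -> (k <= n - 2)%N ->
          lam k < lam j,
        forall k : nat, (1 <= k <= n - 2)%N -> 0 < lam k
      & lam (n - 1)%N = 0 /\ lam n = 0] /\
    [/\ (* (1) *)
        forall v : 'cV[R]_n,
          Omegamx R n *m v = 0 <->
          exists a b : R, v = a *: ones R n + b *: ramp R n,
        (* existence and uniqueness of the eigenvector up to scaling *)
        forall k : nat, (1 <= k <= n - 2)%N ->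
          exists2 u : 'cV[R]_n, eigenvector (Omegamx R n) (lam k) u &
            forall v : 'cV[R]_n, eigenvector (Omegamx R n) (lam k) v ->
              exists2 c : R, c != 0 & v = c *: u,
        (* (2) *)
        forall k : nat, (1 <= k <= n - 2)%N ->
          forall u : 'cV[R]_n, eigenvector (Omegamx R n) (lam k) u ->
            (~~ odd (k - 1) -> even_vec u) /\ (odd (k - 1) -> odd_vec u)
      & (* (3) *)
        forall k : nat, (1 <= k <= n - 2)%N ->
          forall u : 'cV[R]_n, eigenvector (Omegamx R n) (lam k) u ->
            Sminus u = (k + 1)%N /\ Splus u = (k + 1)%N].
Proof.
case: n hn => [|[|m]] // m0.
have {}m0 : (0 < m)%N by [].
have [t [cp st ts t0]] := Omega_spectrum R m.
split.
  split; [exact: Omega_psd0|exact: nullity_Omega|move=> a a0 ea; split=> //].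
  rewrite cp mup_prod_XsubC count_cat count_nseq /= [_ == a]eq_sym.
  have tu : uniq t by rewrite -rev_uniq; apply: lt_sorted_uniq;
    rewrite rev_sorted.
  rewrite gt_eqF // mul0n addn0 count_uniq_mem //.
  have : root (char_poly (Omegamx R m.+2)) a by rewrite -eigenvalue_root_char.
  rewrite cp root_prod_XsubC mem_cat => /orP[->//|].
  by rewrite mem_nseq /= gt_eqF.
have tlast k : (m <= k)%N -> nth 0 t k = 0 by move=> mk;
  rewrite nth_default ?st.
have lam_gt0 k : (1 <= k <= m)%N -> 0 < nth 0 t k.-1.
  by case: k => //= k km; apply/t0/mem_nth; rewrite st.
have lam_dec j k : (1 <= j)%N -> (j < k)%N -> (k <= m)%N ->
  nth 0 t k.-1 < nth 0 t j.-1.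
  case: j k => [|j] [|k] //= _ jk km.
  apply: (sorted_ltn_nth (leT := >%R) _ 0 ts) => //.
  - by move=> x y z /= yx zy; apply: lt_trans yx.
  - by rewrite inE st; apply: ltn_trans km.
  - by rewrite inE st.
have lam_eig k : (1 <= k <= m)%N ->
  exists u, eigenvector (Omegamx R m.+2) (nth 0 t k.-1) u.
  move=> km; apply/eigenvalue_eigenvector => //.
  rewrite eigenvalue_root_char cp root_prod_XsubC mem_cat mem_nth //.
  by case: k km => //= k; rewrite st.
exists (fun k => nth 0 t k.-1); rewrite !subSS subn0; split.
  split=> //; last by rewrite !tlast.
  rewrite cp (big_nth 0) big_add1 /= size_cat st addn2.
  apply: eq_big_nat => k km; rewrite nth_cat st; case: ltnP => // mk.
  by rewrite tlast //; case: (k - m)%N => [|[|[|q]]].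
split.
- move=> v; rewrite Omega_ker0 //; split=> [[c ->]|[b [b' ->]]].
    by exists (c 0 0), (c 1 0); rewrite Xmx_mul.
  by exists (\col_i (if i == 0 then b else b')); rewrite Xmx_mul !mxE.
- move=> k km; have [u eu] := lam_eig k km; exists u => // v ev.
  exact: eigen_unique (lam_gt0 k km) eu ev.
- case=> [//|k] km u eu; rewrite subSS subn0.
  have := eigen_parity m0 lam_dec lam_gt0 lam_eig km eu.
  rewrite /even_vec /odd_vec -signr_odd => ->.
  by case: (odd k); split=> // _; rewrite ?scaleN1r ?scale1r.
- case=> [//|k] km u eu; rewrite addn1.
  exact: (eigen_sign_changes m0 lam_dec lam_gt0 lam_eig km eu).
Qed.
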